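(* Let $(X,d_X,\mu_X)$ and $(Y,d_Y,\mu_Y)$ be two finite mm-spaces, let $p\in[1,\infty]$ and let $d\ge0$ be an integer. Let $w\text{-}\mathrm{PD}_d^{\mathrm{VR}}(X)$ and $w\text{-}\mathrm{PD}_d^{\mathrm{VR}}(Y)$ denote the weighted degree-$d$ persistence diagrams of the weighted Vietoris-Rips filtrations of $X$ and $Y$. Then $$d_{\mathrm{WDgm}}^{E,p}\big(w\text{-}\mathrm{PD}_d^{\mathrm{VR}}(X),w\text{-}\mathrm{PD}_d^{\mathrm{VR}}(Y)\big)\le 2\cdot4^{\frac1p}\cdot d_{\mathrm{CatMM}}^{E,p}\big((X,d_X,\mu_X),(Y,d_Y,\mu_Y)\big)=4^{\frac{p+1}{p}}\cdot d_{\mathrm{GW}_p}\big((X,d_X,\mu_X),(Y,d_Y,\mu_Y)\big),$$ where for $p=\infty$ one reads $\frac1p=0$ and $\frac{p+1}{p}=1$.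
   Context: **mm-spaces and Gromov-Wasserstein.** A finite mm-space $(X,d_X,\mu_X)$ is a non-empty finite metric space with a probability measure of full support. A coupling of $\mu_X,\mu_Y$ is a probability measure $\mu$ on $X\times Y$ with marginals $\mu_X,\mu_Y$. For $p\in[1,\infty)$, $\mathrm{dis}_p(\mu)=\big(\sum_{x,x',y,y'}|d_X(x,x')-d_Y(y,y')|^p\mu(x,y)\mu(x',y')\big)^{1/p}$, and $\mathrm{dis}_\infty(\mu)=\max_{(x,y),(x',y')\in\mathrm{supp}(\mu)}|d_X(x,x')-d_Y(y,y')|$. $d_{\mathrm{GW}_p}(X,Y)=\frac12\inf_\mu\mathrm{dis}_p(\mu)$ over all couplings. **Edit distance.** If $\mathcal C$ is a category whose every morphism carries a cost in $[0,\infty)$, a path between objects $A,B$ is a finite sequence of morphisms $A\leftrightarrow D_1\leftrightarrow\cdots\leftrightarrow D_{k-1}\leftrightarrow B$, each in either direction; its cost is the sum of the costs of its morphisms. The edit distance is the infimum of the costs of all paths between $A$ and $B$ (with $\inf\emptyset=+\infty$). $d^{E,p}_{\mathrm{CatMM}}$ and $d^{E,p}_{\mathrm{WDgm}}$ are the edit distances for the $p$-costs below. **CatMM.** Objects: finite mm-spaces. Morphisms: functions $f:X\to Y$ such that $d_X(x_1,x_2)\le d_X(x_3,x_4)$ implies $d_Y(f(x_1),f(x_2))\le d_Y(f(x_3),f(x_4))$, and $f_\#\mu_X=\mu_Y$. $p$-cost: $\big(\sum_{x,x'\in X}|d_X(x,x')-d_Y(f(x),f(x'))|^p\mu_X(x)\mu_X(x')\big)^{1/p}$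 for $p<\infty$, and $\max_{x,x'}|d_X(x,x')-d_Y(f(x),f(x'))|$ for $p=\infty$. **Intervals and Galois connections.** For a poset $Q$, $\bar Q=\{[q_1,q_2]:q_1\le q_2\}$ with the product order, $\mathrm{diag}(\bar Q)=\{[q,q]\}$. A Galois connection $f:Q\leftrightarrows R:g$ is a pair of order-preserving maps with $f(q)\le r\iff q\le g(r)$; $\bar f([q_1,q_2])=[f(q_1),f(q_2)]$. **Displacement.** For intervals $I_i=[a_i,b_i]$, $J_i=[c_i,d_i]$ ($i=1,2$), $\mathrm{dpl}(I_1,I_2,J_1,J_2)$ is the maximum of $|(a_1-a_2)-(c_1-c_2)|$, $|(a_1-b_2)-(c_1-d_2)|$, $|(b_1-a_2)-(d_1-c_2)|$, $|(b_1-b_2)-(d_1-d_2)|$. **WDgm.** A weighted persistence diagram $w\text{-}\sigma:(\bar Q,\mu_{\bar Q})\to\mathbb N$ consists of a finite $Q\subseteq[0,\infty)$ with $0\in Q$, a function $\sigma:\bar Q\to\mathbb N$ and a probability measure $\mu_{\bar Q}$ on $\bar Q$ such that $\sigma(I)>0$ implies $\mu_{\bar Q}(I)>0$ for $I\in\bar Q\setminus\mathrm{diag}(\bar Q)$. A morphism from $(\sigma,\mu_{\bar Q})$ to $(\tau,\mu_{\bar R})$ is a Galois connection $f:Q\leftrightarrows R:g$ with $\tau(J)=\sum_{\bar f(I)=J}\sigma(I)$ for all $J\in\bar R\setminus\mathrm{diag}(\bar R)$ and $\bar f_\#\mu_{\bar Q}=\mu_{\bar R}$. Its $p$-cost is $\big(\sum_{I_1,I_2\in\bar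 Q}\mathrm{dpl}(I_1,I_2,\bar f(I_1),\bar f(I_2))^p\mu_{\bar Q}(I_1)\mu_{\bar Q}(I_2)\big)^{1/p}$ for $p<\infty$ and $\max_{I_1,I_2\in\bar Q}\mathrm{dpl}(I_1,I_2,\bar f(I_1),\bar f(I_2))$ for $p=\infty$. **Weighted Vietoris-Rips diagrams.** Let $D_X=\mathrm{im}(d_X)\subseteq[0,\infty)$. The Vietoris-Rips filtration $\mathrm{VR}(X)$ sends $r\in D_X$ to the simplicial complex of non-empty subsets of $X$ of diameter at most $r$. The weighted Vietoris-Rips filtration is $\mathrm{VR}(X)$ with the weight $\mu_{GDD(X)}=(d_X)_\#(\mu_X\otimes\mu_X)$ on $D_X$. Fix a field $\Bbbk$. For a filtration $F$ indexed by finite $Q$, of a finite simplicial complex $K$, put $\mathrm{ZB}_d^F([q_i,q_j])=\dim(Z_d(F(q_i))\cap B_d(F(q_j)))$ ($Z_d$, $B_d$ simplicial cycles and boundaries over $\Bbbk$, inside the chain space of $K$), and let $\mathrm{PD}_d^F:\bar Q\to\mathbb Z$ be its Möbius inverse: $\mathrm{ZB}_d^F(I)=\sum_{I'\le I}\mathrm{PD}_d^F(I')$ for all $I$; it is known to take values in $\mathbb N$. With $\mathrm{flip}:Q\times Q\to\bar Q$, $\mathrm{flip}(q_1,q_2)=[\min(q_1,q_2),\max(q_1,q_2)]$, the weighted degree-$d$ persistence diagram of a weighted filtration $(F,\mu_Q)$ is $\mathrm{PD}_d^F$ with the weight $\mathrm{flip}_\#(\mu_Q\otimes\mu_Q)$.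 Applied to the weighted Vietoris-Rips filtration, this gives $w\text{-}\mathrm{PD}_d^{\mathrm{VR}}(X)$. *)

(* Defs.v *)
(* MathComp + MathComp-Analysis. *)
From HB Require Import structures.
From mathcomp Require Import all_boot all_order all_algebra finmap.
From mathcomp Require Import reals constructive_ereal ereal exp.

Set Implicit Arguments.
Unset Strict Implicit.
Unset Printing Implicit Defensive.

Import Order.TTheory GRing.Theory Num.Theory.
Local Open Scope ring_scope.

Section FiniteMeasures.
Variable R : realType.

(* Measures on a finite type are given by their mass functions. *)
Definition pushforward (S T : finType) (f : S -> T) (mu : S -> R) : T -> R :=
  fun t => \sum_(s | f s == t) mu s.

Definition prod_mass (S T : finType) (mu : S -> R) (nu : T -> R) :
  S * T -> R := fun u => mu u.1 * nu u.2.

(* The weighted p-norm of f; for p = +oo it is the maximum of |f| over A, which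
   is chosen separately because some maxima below range over the support of mu
   and others over the whole index type.  The value at p = -oo is irrelevant. *)
Definition pnorm (I : finType) (p : \bar R) (A : pred I) (mu f : I -> R) : R :=
  if p is r%:E then (\sum_i `|f i| `^ r * mu i) `^ r^-1
  else \big[Num.max/0]_(i | A i) `|f i|.

(* 1/p and (p+1)/p, with the conventions 1/oo = 0 and (oo+1)/oo = 1. *)
Definition exponent_inv (p : \bar R) : R := if p is r%:E then r^-1 else 0.
Definition exponent_succ_div (p : \bar R) : R :=
  if p is r%:E then (r + 1) / r else 1.

Lemma pushforward_sum (S T : finType) (f : S -> T) (mu : S -> R) :
  \sum_t pushforward f mu t = \sum_s mu s.
Proof.
by rewrite /pushforward (partition_big f xpredT) //; apply: eq_bigr.
Qed.

Lemma prod_mass_sum (S T : finType) (mu : S -> R) (nu : T -> R) :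
  \sum_u prod_mass mu nu u = (\sum_s mu s) * (\sum_t nu t).
Proof.
rewrite big_distrl /= -(pair_bigA _ (fun s t => mu s * nu t)) /=.
by apply: eq_bigr => s _; rewrite big_distrr.
Qed.

Lemma pushforward_gt0 (S T : finType) (f : S -> T) (mu : S -> R) (t : T) :
  (forall s, 0 < mu s) -> (exists s, f s = t) -> 0 < pushforward f mu t.
Proof.
move=> mu0 [s fs]; rewrite /pushforward (bigD1 s) ?fs //=.
by apply: ltr_wpDr => //; apply: sumr_ge0 => i _; apply: ltW.
Qed.

End FiniteMeasures.

Section EditDistance.
Variable R : realType.

(* Composition and identities of the category play no role in the edit
   distance: only objects, morphisms and costs enter. *)
Variables (Ob : Type) (Hom : Ob -> Ob -> Type).
Variable cost : forall A B : Ob, Hom A B -> R.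

Inductive step (A B : Ob) : Type :=
  | Forward of Hom A B
  | Backward of Hom B A.

Inductive zigzag : Ob -> Ob -> Type :=
  | ZOne A B : step A B -> zigzag A B
  | ZCons A B C : step A B -> zigzag B C -> zigzag A C.

Definition step_cost A B (s : step A B) : R :=
  match s with Forward f => cost f | Backward f => cost f end.

Fixpoint zigzag_cost A B (P : zigzag A B) : R :=
  match P with
  | ZOne _ _ s => step_cost s
  | ZCons _ _ _ s P' => step_cost s + zigzag_cost P'
  end.

Definition edit_dist (A B : Ob) : \bar R :=
  ereal_inf (fun c : \bar R =>
    exists P : zigzag A B, c = (zigzag_cost P)%:E).

End EditDistance.

Section MMSpaces.
Variable R : realType.

(* Non-emptiness follows from mass_sum, non-negativity of the metric from the
   other metric axioms. *)
Record mmSpace := MMSpace {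
  point :> finType;
  dist : point -> point -> R;
  mass : point -> R;
  dist_eq0 : forall x y, dist x y = 0 <-> x = y;
  dist_sym : forall x y, dist x y = dist y x;
  dist_triangle : forall x y z, dist x z <= dist x y + dist y z;
  mass_gt0 : forall x, 0 < mass x;
  mass_sum : \sum_x mass x = 1 }.

Definition is_coupling (X Y : mmSpace) (mu : X * Y -> R) : Prop :=
  [/\ forall u, 0 <= mu u,
      forall x, \sum_y mu (x, y) = mass x
    & forall y, \sum_x mu (x, y) = mass y].

Definition distortion (X Y : mmSpace) (p : \bar R) (mu : X * Y -> R) : R :=
  pnorm p (fun u => (0 < mu u.1) && (0 < mu u.2)) (prod_mass mu mu)
    (fun u => dist u.1.1 u.2.1 - dist u.1.2 u.2.2).

Definition gw_dist (p : \bar R) (X Y : mmSpace) : \bar R :=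
  ((2^-1)%:E * ereal_inf (fun c : \bar R =>
     exists mu : X * Y -> R, is_coupling mu /\ c = (distortion p mu)%:E))%E.

Record mm_hom (X Y : mmSpace) := MMHom {
  mm_fun :> X -> Y;
  mm_fun_order : forall x1 x2 x3 x4, dist x1 x2 <= dist x3 x4 ->
    dist (mm_fun x1) (mm_fun x2) <= dist (mm_fun x3) (mm_fun x4);
  mm_fun_mass : pushforward mm_fun (@mass X) =1 @mass Y }.

Definition mm_cost (p : \bar R) (X Y : mmSpace) (f : mm_hom X Y) : R :=
  pnorm p predT (prod_mass (@mass X) (@mass X))
    (fun u => dist u.1 u.2 - dist (f u.1) (f u.2)).

Definition catMM_dist (p : \bar R) : mmSpace -> mmSpace -> \bar R :=
  edit_dist (mm_cost p).

Lemma dist_ge0 (X : mmSpace) (x y : X) : 0 <= dist x y.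
Proof.
have := dist_triangle x y x; rewrite (dist_sym y x).
have /dist_eq0 -> : x = x by [].
by rewrite -mulr2n pmulrn_lge0.
Qed.

End MMSpaces.

Section Intervals.
Variable R : realType.

Record intv (Q : {fset R}) := Intv {
  ends : Q * Q;
  ends_le : val ends.1 <= val ends.2 }.

HB.instance Definition _ (Q : {fset R}) := [isSub for @ends Q].
HB.instance Definition _ (Q : {fset R}) := [Finite of intv Q by <:].

Definition lo (Q : {fset R}) (I : intv Q) : R := val (ends I).1.
Definition hi (Q : {fset R}) (I : intv Q) : R := val (ends I).2.

Definition intv_le (Q : {fset R}) : rel (intv Q) :=
  fun I J => (lo I <= lo J) && (hi I <= hi J).

Definition in_diag (Q : {fset R}) : pred (intv Q) := fun I => lo I == hi I.

Record galois (Q S : {fset R}) := Galois {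
  gal_lower : Q -> S;
  gal_upper : S -> Q;
  gal_lower_mono : forall q q', val q <= val q' ->
    val (gal_lower q) <= val (gal_lower q');
  gal_upper_mono : forall r r', val r <= val r' ->
    val (gal_upper r) <= val (gal_upper r');
  gal_adj : forall q r, val (gal_lower q) <= val r <->
    val q <= val (gal_upper r) }.

Definition gal_bar (Q S : {fset R}) (f : galois Q S) (I : intv Q) : intv S :=
  Intv (ends := (gal_lower f (ends I).1, gal_lower f (ends I).2))
    (gal_lower_mono f (ends_le I)).

Lemma flip_subproof (Q : {fset R}) (u : Q * Q) :
  let v := if val u.1 <= val u.2 then u else (u.2, u.1) in
  val v.1 <= val v.2.
Proof. by case: ifPn => //=; rewrite -ltNge => /ltW. Qed.

Definition flip (Q : {fset R}) (u : Q * Q) : intv Q :=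
  Intv (flip_subproof u).

Definition displacement (Q S : {fset R}) (I1 I2 : intv Q)
    (J1 J2 : intv S) : R :=
  Num.max
    (Num.max `|(lo I1 - lo I2) - (lo J1 - lo J2)|
             `|(lo I1 - hi I2) - (lo J1 - hi J2)|)
    (Num.max `|(hi I1 - lo I2) - (hi J1 - lo J2)|
             `|(hi I1 - hi I2) - (hi J1 - hi J2)|).

End Intervals.

Section WeightedDiagrams.
Variable R : realType.

Record wdgm := WDgm {
  scale : {fset R};
  scale0 : 0 \in scale;
  scale_ge0 : forall q, q \in scale -> 0 <= q;
  mult : intv scale -> nat;
  wt : intv scale -> R;
  wt_ge0 : forall I, 0 <= wt I;
  wt_sum : \sum_I wt I = 1;
  wt_supp : forall I, ~~ in_diag I -> (0 < mult I)%N -> 0 < wt I }.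

Record wdgm_hom (s t : wdgm) := WDgmHom {
  hom_galois :> galois (scale s) (scale t);
  hom_mult : forall J, ~~ in_diag J ->
    mult J = (\sum_(I | gal_bar hom_galois I == J) mult I)%N;
  hom_wt : pushforward (gal_bar hom_galois) (@wt s) =1 @wt t }.

Definition wdgm_cost (p : \bar R) (s t : wdgm) (f : wdgm_hom s t) : R :=
  pnorm p predT (prod_mass (@wt s) (@wt s))
    (fun u => displacement u.1 u.2 (gal_bar f u.1) (gal_bar f u.2)).

Definition wdgm_dist (p : \bar R) : wdgm -> wdgm -> \bar R :=
  edit_dist (wdgm_cost p).

End WeightedDiagrams.

(* The integer-valued g with f x = \sum_(y <= x) g y; see mobius_invP. *)
Section Mobius.
Variables (T : finType) (le : rel T).

Fixpoint mobius_rec (n : nat) (f : T -> int) (x : T) : int :=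
  if n is m.+1 then
    f x - \sum_(y | le y x && (y != x)) mobius_rec m f y
  else 0.

Definition mobius_inv (f : T -> int) (x : T) : int := mobius_rec #|T| f x.

Hypotheses (le_refl : reflexive le) (le_trans : transitive le).
Hypothesis le_anti : antisymmetric le.

Let down x := #|[pred y | le y x]|.

Let down_gt0 x : (0 < down x)%N.
Proof. by apply/card_gt0P; exists x; rewrite inE le_refl. Qed.

Let down_lt x y : le y x -> y != x -> (down y < down x)%N.
Proof.
move=> yx nyx; apply/proper_card/properP; split.
  by apply/subsetP => z; rewrite !inE => /le_trans; apply.
exists x; rewrite !inE ?le_refl //; apply/negP => xy.
by case/eqP: nyx; apply: le_anti; rewrite yx.
Qed.

Lemma mobius_rec_eq n m f x : (down x <= n)%N -> (down x <= m)%N ->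
  mobius_rec n f x = mobius_rec m f x.
Proof.
elim: n m x => [|n IHn] [|m] x; rewrite ?leqn0 ?(gtn_eqF (down_gt0 x)) //.
move=> xn xm /=; congr (_ - _); apply: eq_bigr => y /andP[yx nyx].
have yx_lt := down_lt yx nyx.
by apply: IHn; rewrite -ltnS; apply: leq_trans yx_lt _.
Qed.

Lemma mobius_invE f x :
  mobius_inv f x = f x - \sum_(y | le y x && (y != x)) mobius_inv f y.
Proof.
rewrite {1}/mobius_inv (@mobius_rec_eq _ #|T|.+1) ?max_card //.
exact/leqW/max_card.
Qed.

Lemma mobius_invP f x : f x = \sum_(y | le y x) mobius_inv f y.
Proof. by rewrite (bigD1 x) //= mobius_invE subrK. Qed.

Lemma mobius_inv_unique f g :
  (forall x, f x = \sum_(y | le y x) g y) -> g =1 mobius_inv f.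
Proof.
move=> fg x; have [n] := ubnP (down x).
elim: n x => // n IHn x; rewrite ltnS => xn.
have := fg x; rewrite (bigD1 x) //= mobius_invE => ->.
rewrite (eq_bigr (mobius_inv f)) ?addrK // => y /andP[yx nyx].
exact/IHn/(leq_trans (down_lt yx nyx)).
Qed.

End Mobius.

Section Chains.
Variables (K : fieldType) (V : finType).

Notation chain := {ffun {set V} -> K^o}.

(* A simplex is oriented by the enumeration order of V. The coefficient of the
   boundary of c at t collects the simplices v |: t with v notin t, with the
   sign given by the position of v. There is no face of dimension -1, so homology is
   not reduced. *)
Definition vertex_pos (v : V) (t : {set V}) : nat :=
  #|[set u in t | (enum_rank u < enum_rank v)%N]|.

Definition boundary (c : chain) : chain :=
  [ffun t : {set V} => if t == set0 then 0 else
    \sum_(v | v \notin t) (-1) ^+ vertex_pos v t *: c (v |: t)%SET].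

Lemma boundary_is_linear : linear boundary.
Proof.
move=> a c c'; apply/ffunP => t; rewrite !ffunE.
case: eqP => _; first by rewrite scaler0 addr0.
rewrite scaler_sumr -big_split /=; apply: eq_bigr => v _.
by rewrite !ffunE scalerDr !scalerA mulrC.
Qed.

HB.instance Definition _ :=
  GRing.isLinear.Build K chain chain *:%R boundary boundary_is_linear.

Definition simplex_chain (s : {set V}) : chain := [ffun t => (t == s)%:R].

Definition chains (d : nat) (S : {set {set V}}) : {vspace chain} :=
  <<[seq simplex_chain s | s : {set V} <- enum S & #|s| == d.+1]>>%VS.

Definition cycles (d : nat) (S : {set {set V}}) : {vspace chain} :=
  (chains d S :&: lker (linfun boundary))%VS.

Definition boundaries (d : nat) (S : {set {set V}}) : {vspace chain} :=
  (linfun boundary @: chains d.+1 S)%VS.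

Lemma chains_sub d (S S' : {set {set V}}) :
  S \subset S' -> (chains d S <= chains d S')%VS.
Proof.
move=> /subsetP SS'; apply: sub_span => c /mapP[s].
rewrite mem_filter mem_enum => /andP[sd sS] ->.
by apply: map_f; rewrite mem_filter sd mem_enum SS'.
Qed.

Lemma cycles_sub d (S S' : {set {set V}}) :
  S \subset S' -> (cycles d S <= cycles d S')%VS.
Proof. by move=> SS'; apply: capvS => //; apply: chains_sub. Qed.

Lemma boundaries_sub d (S S' : {set {set V}}) :
  S \subset S' -> (boundaries d S <= boundaries d S')%VS.
Proof. by move=> SS'; apply: limgS; apply: chains_sub. Qed.

End Chains.

Section PersistenceDiagrams.
Variable R : realType.

Record filtration (V : finType) (Q : {fset R}) := Filtration {
  cplx :> Q -> {set {set V}};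
  cplx_nonempty : forall q, set0 \notin cplx q;
  cplx_face : forall q (s t : {set V}), s \in cplx q -> t != set0 ->
    t \subset s -> t \in cplx q;
  cplx_mono : forall q q', val q <= val q' -> cplx q \subset cplx q' }.

Variables (K : fieldType) (V : finType).

Definition zb (d : nat) (Q : {fset R}) (F : filtration V Q)
    (I : intv Q) : nat :=
  \dim (cycles K d (F (ends I).1) :&: boundaries K d (F (ends I).2))%VS.

(* The Moebius inverse of zb takes non-negative values (pd_ge0), so taking the
   absolute value below only changes its codomain from int to nat. *)
Definition pd (d : nat) (Q : {fset R}) (F : filtration V Q)
    (I : intv Q) : nat :=
  `|mobius_inv (@intv_le R Q) (fun J => (zb d F J)%:Z) I|%N.

Lemma intv_le_refl (Q : {fset R}) : reflexive (@intv_le R Q).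
Proof. by move=> I; rewrite /intv_le !lexx. Qed.

Lemma intv_le_trans (Q : {fset R}) : transitive (@intv_le R Q).
Proof.
move=> J I L /andP[IJl IJh] /andP[JLl JLh].
by rewrite /intv_le (le_trans IJl JLl) (le_trans IJh JLh).
Qed.

Lemma intv_eqP (Q : {fset R}) (I J : intv Q) :
  lo I = lo J -> hi I = hi J -> I = J.
Proof.
case: I J => [[a b] ab] [[c e] ce] /val_inj /= ac /val_inj /= be.
by apply: val_inj; rewrite /= ac be.
Qed.

Lemma intv_le_anti (Q : {fset R}) : antisymmetric (@intv_le R Q).
Proof.
move=> I J /andP[/andP[l h] /andP[l' h']].
by apply: intv_eqP; apply: le_anti; rewrite ?l ?h.
Qed.

Section Nonnegativity.
Variables (d : nat) (Q : {fset R}) (F : filtration V Q).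

Let g := mobius_inv (@intv_le R Q) (fun J => (zb d F J)%:Z).

Let gP I : (zb d F I)%:Z = \sum_(J | intv_le J I) g J.
Proof.
exact: (mobius_invP (@intv_le_refl Q) (@intv_le_trans Q) (@intv_le_anti Q)
  (fun J => (zb d F J)%:Z)).
Qed.

Let pred_spec (q : Q) :
  {q' : Q | val q' < val q /\ forall r : Q, val r < val q -> val r <= val q'} +
  {forall r : Q, val q <= val r}.
Proof.
case: (pickP [pred r : Q | val r < val q]) => [q0 /= q0q | noq].
  left.
  case: (@arg_maxP _ _ _ q0 (fun r : Q => val r < val q) val q0q) => q' q'q qm.
  by exists q'; split.
by right => r; rewrite leNgt; have /= -> := noq r.
Qed.

Let g_strict I : g I = (zb d F I)%:Z - \sum_(J | intv_le J I && (J != I)) g J.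
Proof. by rewrite gP (bigD1 I) ?intv_le_refl //= addrK. Qed.

Let neqE (I J : intv Q) : intv_le J I ->
  (J != I) = (lo J < lo I) || (hi J < hi I).
Proof.
move=> /andP[l h]; rewrite !lt_neqAle l h !andbT -negb_and.
apply/idP/idP; apply: contra; last by move=> /eqP ->; rewrite !eqxx.
by move=> /andP[/eqP el /eqP eh]; apply/eqP/intv_eqP.
Qed.

Let zb_le I J : intv_le I J -> (zb d F I <= zb d F J)%N.
Proof.
move=> /andP[l h]; apply: dimvS; apply: capvS.
  exact/cycles_sub/cplx_mono.
exact/boundaries_sub/cplx_mono.
Qed.

Let ge0_one I J : (forall L, intv_le L I && (L != I) = intv_le L J) ->
  intv_le J I -> 0 <= g I.
Proof.
move=> E JI; rewrite g_strict (eq_bigl _ _ E) -gP subr_ge0.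
by have := zb_le JI.
Qed.

Lemma pd_ge0 (I : intv Q) :
  0 <= mobius_inv (@intv_le R Q) (fun J => (zb d F J)%:Z) I.
Proof.
rewrite -/(g I).
have loI : lo I <= hi I := ends_le I.
have [[a' [a'a a'max]]|amin] := pred_spec (ends I).1.
- have a'h : val a' <= val (ends I).2 := le_trans (ltW a'a) loI.
  pose I1 : intv Q := Intv (ends := (a', (ends I).2)) a'h.
  have lt_a' (r : Q) : (val r < lo I) = (val r <= val a').
    by apply/idP/idP => [/a'max // | ra]; apply: le_lt_trans ra a'a.
  have I1I : intv_le I1 I by rewrite /intv_le /lo /hi /= lexx (ltW a'a).
  case: (ltgtP (lo I) (hi I)) loI => // [ab|ab] _.
  + have [[b' [b'b b'max]]|bmin] := pred_spec (ends I).2; last first.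
      by have := bmin (ends I).1; rewrite leNgt -/(lo I) -/(hi I) ab.
    have lt_b' (r : Q) : (val r < hi I) = (val r <= val b').
      by apply/idP/idP => [/b'max // | rb]; apply: le_lt_trans rb b'b.
    have ab' : val (ends I).1 <= val b' by rewrite -lt_b'.
    have a'b' : val a' <= val b' := le_trans (ltW a'a) ab'.
    pose I2 : intv Q := Intv (ends := ((ends I).1, b')) ab'.
    pose I3 : intv Q := Intv (ends := (a', b')) a'b'.
    have E1 L : (intv_le L I && (L != I)) && intv_le L I1 = intv_le L I1.
      apply/andP/idP => [[] //|LI1]; split => //; apply/andP.
      have LI := intv_le_trans LI1 I1I; split => //.
      by rewrite neqE // /lo lt_a'; case/andP: LI1 => ->.
    have E2 L : (intv_le L I && (L != I)) && ~~ intv_le L I1 =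
        intv_le L I2 && ~~ intv_le L I3.
      have le1 : intv_le L I1 = (lo L <= val a') && (hi L <= hi I) by [].
      have le2 : intv_le L I2 = (lo L <= lo I) && (hi L <= val b') by [].
      have le3 : intv_le L I3 = (lo L <= val a') && (hi L <= val b') by [].
      rewrite le1 le2 le3; case: (boolP (intv_le L I)) => LI /=.
        rewrite neqE // [lo L < _]lt_a' [hi L < _]lt_b'.
        have /andP[-> ->] := LI; rewrite andbT /=.
        by case: (lo L <= _); case: (hi L <= _).
      apply/esym/negbTE; apply: contra LI => /andP[/andP[l h] _].
      by rewrite /intv_le l (le_trans h (ltW b'b)).
    rewrite g_strict (bigID (fun L => intv_le L I1)) /= (eq_bigl _ _ E1) -gP.
    rewrite (eq_bigl _ _ E2).
    have I3I2 : intv_le I3 I2 by rewrite /intv_le /lo /hi /= lexx (ltW a'a).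
    have := gP I2; rewrite (bigID (fun L => intv_le L I3)) /=.
    have E3 L : intv_le L I2 && intv_le L I3 = intv_le L I3.
      apply/andP/idP => [[] //|LI3]; split => //.
      exact: intv_le_trans LI3 I3I2.
    rewrite (eq_bigl _ _ E3) -gP addrC => /esym/eqP; rewrite eq_sym -subr_eq.
    move=> /eqP <-; rewrite subr_ge0 addrA lerBlDr -!PoszD lez_nat.
    rewrite /zb /=.
    set Za := cycles K d (F (ends I).1); set Zp := cycles K d (F a').
    set Bb := boundaries K d (F (ends I).2); set Bp := boundaries K d (F b').
    have ZpZ : (Zp <= Za)%VS by apply/cycles_sub/cplx_mono/ltW.
    have BpB : (Bp <= Bb)%VS by apply/boundaries_sub/cplx_mono/ltW.
    rewrite -dimv_sum_cap; apply: leq_add; apply: dimvS.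
      by rewrite subv_add; apply/andP; split; apply: capvS.
    rewrite subv_cap; apply/andP; split.
      by apply: (subv_trans (capvSl _ _)); apply: capvSl.
    by apply: (subv_trans (capvSr _ _)); apply: capvSr.
  + apply: (@ge0_one I I1) => // L.
    apply/andP/idP => [[LI]|LI1].
      rewrite neqE // => LN; apply/andP; split; last by case/andP: LI.
      rewrite {2}/lo /= -lt_a' -/(lo L); case/orP: LN => // h.
      by apply: le_lt_trans (ends_le L) _; rewrite ab.
    have LI := intv_le_trans LI1 I1I; split => //.
    by rewrite neqE // /lo lt_a'; case/andP: LI1 => ->.
- have [[b' [b'b b'max]]|bmin] := pred_spec (ends I).2.
  + have lt_b' (r : Q) : (val r < hi I) = (val r <= val b').
      by apply/idP/idP => [/b'max // | rb]; apply: le_lt_trans rb b'b.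
    pose I2 : intv Q := Intv (ends := ((ends I).1, b')) (amin b').
    have I2I : intv_le I2 I by rewrite /intv_le /lo /hi /= lexx (ltW b'b).
    apply: (@ge0_one I I2) => // L.
    apply/andP/idP => [[LI]|LI2].
      rewrite neqE // ltNge amin /= => h.
      by case/andP: LI => l _; rewrite /intv_le l /= /hi -lt_b'.
    have LI := intv_le_trans LI2 I2I; split => //.
    by rewrite neqE // [X in _ || X]lt_b'; case/andP: LI2 => _ ->; rewrite orbT.
  + rewrite g_strict big_pred0 ?subr0 // => L; apply/negbTE/negP => /andP[LI].
    by rewrite neqE // ltNge amin ltNge bmin.
Qed.

End Nonnegativity.

Lemma pdP (d : nat) (Q : {fset R}) (F : filtration V Q) (I : intv Q) :
  zb d F I = (\sum_(J | intv_le J I) pd d F J)%N.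
Proof.
apply/eqP; rewrite -eqz_nat (big_morph Posz PoszD (erefl 0%:Z)); apply/eqP.
rewrite (mobius_invP (@intv_le_refl Q) (@intv_le_trans Q) (@intv_le_anti Q)
  (fun J => (zb d F J)%:Z)).
by apply: eq_bigr => J _; rewrite /pd gez0_abs ?pd_ge0.
Qed.

End PersistenceDiagrams.

Section WeightedFiltrations.
Variable R : realType.

(* The weight has full support, which ensures the support condition of the
   associated weighted diagram. *)
Record wfiltration (V : finType) := WFiltration {
  index : {fset R};
  index0 : 0 \in index;
  index_ge0 : forall q, q \in index -> 0 <= q;
  filt :> filtration V index;
  fwt : index -> R;
  fwt_gt0 : forall q, 0 < fwt q;
  fwt_sum : \sum_q fwt q = 1 }.

Section WPD.
Variables (K : fieldType) (V : finType) (d : nat) (F : wfiltration V).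

Definition flip_wt : intv (index F) -> R :=
  pushforward (@flip R (index F)) (prod_mass (@fwt V F) (@fwt V F)).

Lemma flip_wt_gt0 I : 0 < flip_wt I.
Proof.
apply: pushforward_gt0 => [u|]; first by rewrite mulr_gt0 ?fwt_gt0.
by exists (ends I); apply: val_inj => /=; rewrite (ends_le I).
Qed.

Lemma flip_wt_sum : \sum_I flip_wt I = 1.
Proof. by rewrite pushforward_sum prod_mass_sum fwt_sum mulr1. Qed.

Definition wpd : wdgm R :=
  @WDgm R (index F) (index0 F) (@index_ge0 V F) (pd K d F) flip_wt
    (fun I => ltW (flip_wt_gt0 I)) flip_wt_sum (fun I _ _ => flip_wt_gt0 I).

End WPD.

Section VietorisRips.
Variable X : mmSpace R.

Definition dist_set : {fset R} := [fset dist u.1 u.2 | u : X * X]%fset.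

Lemma dist_setP (u : X * X) : dist u.1 u.2 \in dist_set.
Proof. by apply/imfsetP; exists u. Qed.

Definition dist_to_set (u : X * X) : dist_set := [` dist_setP u]%fset.

Definition gdd : dist_set -> R :=
  pushforward dist_to_set (prod_mass (@mass R X) (@mass R X)).

Definition vr_cplx (r : dist_set) : {set {set X}} :=
  [set s : {set X} | (s != set0) &&
    [forall x in s, forall y in s, dist x y <= val r]]%SET.

Lemma vr_nonempty r : set0 \notin vr_cplx r.
Proof. by rewrite inE eqxx. Qed.

Lemma vr_face r (s t : {set X}) : s \in vr_cplx r -> t != set0 ->
  t \subset s -> t \in vr_cplx r.
Proof.
rewrite !inE => /andP[_ /forall_inP sr] -> /subsetP ts /=.
apply/forall_inP => x /ts /sr /forall_inP xr.
by apply/forall_inP => y /ts /xr.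
Qed.

Lemma vr_mono (r r' : dist_set) :
  val r <= val r' -> vr_cplx r \subset vr_cplx r'.
Proof.
move=> rr'; apply/subsetP => s; rewrite !inE => /andP[-> /forall_inP sr] /=.
apply/forall_inP => x /sr /forall_inP xr.
by apply/forall_inP => y /xr /le_trans; apply.
Qed.

Definition vr_filtration : filtration X dist_set :=
  Filtration vr_nonempty vr_face vr_mono.

Lemma dist_set0 : 0 \in dist_set.
Proof.
have [x _|X0] := pickP (@predT X).
  by apply/imfsetP; exists (x, x) => //=; apply/esym/dist_eq0.
have := mass_sum X; rewrite big_pred0 => [/eqP|x].
  by rewrite eq_sym oner_eq0.
by have := X0 x.
Qed.

Lemma dist_set_ge0 q : q \in dist_set -> 0 <= q.
Proof. by case/imfsetP => u _ ->; apply: dist_ge0. Qed.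

Lemma gdd_gt0 q : 0 < gdd q.
Proof.
apply: pushforward_gt0 => [u|]; first by rewrite mulr_gt0 ?mass_gt0.
by case/imfsetP: (valP q) => u _ qu; exists u; apply: val_inj; rewrite /= -qu.
Qed.

Lemma gdd_sum : \sum_q gdd q = 1.
Proof. by rewrite pushforward_sum prod_mass_sum mass_sum mulr1. Qed.

Definition weighted_vr : wfiltration X :=
  @WFiltration X dist_set dist_set0 dist_set_ge0 vr_filtration gdd
    gdd_gt0 gdd_sum.

End VietorisRips.

Definition wpd_vr (K : fieldType) (d : nat) (X : mmSpace R) : wdgm R :=
  wpd K d (weighted_vr X).

End WeightedFiltrations.

(* Main.v *)
From HB Require Import structures.
Require Import Defs.
From mathcomp Require Import all_boot all_order all_algebra.
From mathcomp Require Import reals constructive_ereal ereal exp.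
From mathcomp Require Import finmap zify ring lra.
From mathcomp Require hoelder classical_sets interval_inference.
Import Order.TTheory GRing.Theory Num.Theory.
Local Open Scope ring_scope.

(** The factor 2 * 4 `^ (1 / p) comes from comparing the costs of a morphism
    of mm-spaces and of the morphism of diagrams that it induces; the equality
    says that the edit distance of mm-spaces is twice the Gromov-Wasserstein
    distance.

    Edit distance and couplings. A morphism f : X -> Y pushes the mass of X
    forward along x |-> (x, f x) to a coupling whose distortion is the cost of
    f.  Couplings can be glued along a common marginal, and Minkowski's
    inequality on the glued space makes the distortion subadditive, so every
    zigzag yields a coupling that is at most as expensive
    ([zigzag_coupling]).  Conversely, let mu be a coupling with support Z, and
    put d_t = (1 - t) d_X + t d_Y on Z.  For 0 < t < 1 this is a metric, the
    projections play the part of d_0 and d_1, and identifying the points of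
    Z at time s with those at time t costs |s - t| times the distortion of mu.
    Each comparison d_t(a, b) <= d_t(a', b') is affine in t, so only finitely
    many times are critical.  Between two consecutive critical times l < r no
    comparison flips, and a weak inequality at the midpoint m persists at l and
    r: this gives morphisms Z_l <- Z_m -> Z_r of total cost (r - l) times the
    distortion.  Concatenating them leads from X to Y at the cost of mu
    ([coupling_reach]).

    Diagrams. A morphism f : X -> Y of mm-spaces is surjective, since masses
    are positive, and it induces a monotone map D_X -> D_Y that preserves 0 and
    hence has an upper adjoint g.  The Vietoris-Rips complex of X at scale g(r)
    consists of all simplices whose image under f belongs to the complex of Y
    at scale r.  Such a preimage retracts to the original complex: vertices in
    the same fibre can be merged one after the other, each merging being
    chain homotopic to the identity, until the image of a section is left.
    Therefore the differences dim (Z_a \cap B_b) - dim Z_a agree for the two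
    filtrations ([pull_cplx_dim]), so that the two functions ZB differ by
    a function of the left end point alone, and such a difference is not seen
    by Moebius inversion away from the diagonal ([offdiag_eq]).  This makes f
    a morphism of diagrams.  Its displacement at two intervals is at most twice
    the largest displacement of their four end points, and each end point has
    the distribution of the distances of X; replacing the p-th power of a
    maximum of four terms by their sum gives the constant
    ([wdgm_cost_induced]). *)

Set Implicit Arguments.
Unset Strict Implicit.
Unset Printing Implicit Defensive.


(** * Exterior calculus on chains *)

(** Elements of Z that phi kills are sent to 0 \in B', so they lie in B: phi has
    the same kernel on Z :&: B as on Z, and rank-nullity applies to both.  With Z
    the cycles of a complex and B the boundaries of a larger one, the equality
    says that the difference of the dimensions of Z :&: B and Z is preserved. *)
Lemma dim_cap_transfer (K : fieldType) (U V : vectType K) (phi : 'Hom(U, V))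
    (Z B : {vspace U}) (Z' B' : {vspace V}) :
  (phi @: Z)%VS = Z' -> {in Z, forall z, (z \in B) = (phi z \in B')} ->
  (\dim (Z :&: B) + \dim Z' = \dim (Z' :&: B') + \dim Z)%N.
Proof.
move=> im_phi eqB.
have im_cap : (phi @: (Z :&: B))%VS = (Z' :&: B')%VS.
  apply/eqP; rewrite eqEsubv; apply/andP; split; apply/subvP => y.
    move/memv_imgP => [z /[!memv_cap] /andP[zZ zB] ->].
    by rewrite -im_phi memv_img //= -eqB.
  rewrite memv_cap -im_phi => /andP[/memv_imgP[z zZ ->] zB].
  by rewrite memv_img // memv_cap zZ eqB.
have ker_cap : (Z :&: B :&: lker phi)%VS = (Z :&: lker phi)%VS.
  apply/eqP; rewrite eqEsubv capvS ?capvSl //=.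
  apply/subvP => z; rewrite !memv_cap => /andP[zZ zk].
  by rewrite zZ zk eqB // (eqP (_ : phi z == 0)) ?mem0v // -memv_ker.
rewrite -(limg_ker_dim phi (Z :&: B)) -(limg_ker_dim phi Z) im_cap ker_cap im_phi.
by rewrite -addnA addnC addnAC addnA.
Qed.

Section Chains.
Variables (K : fieldType) (V : finType).
Notation chain := {ffun {set V} -> K^o}.
Implicit Types (c : chain) (s t : {set V}) (S : {set {set V}}) (u v w : V).

(** With this description by supports, membership of a transformed chain
    becomes a statement about single simplices. *)
Lemma chainsP d S c :
  reflect (forall t, c t != 0 -> t \in S /\ #|t| = d.+1)
          (c \in chains K d S).
Proof.
apply: (iffP idP) => [|supp_c].
  set X := [seq simplex_chain K s | s : {set V} <- enum S & #|s| == d.+1].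
  rewrite /chains -/X => /(coord_span (X := in_tuple X)) -> t; rewrite sum_ffunE.
  move=> nz; have [i ni] : exists i : 'I_(size X), X`_i t != 0.
    apply/existsP; apply: contraNT nz; rewrite negb_exists => /forallP all0.
    apply/eqP/big1 => i _; rewrite ffunE.
    by have /negPn/eqP /= -> := all0 i; rewrite scaler0.
  have /mapP[s] := mem_nth 0 (ltn_ord i).
  rewrite mem_filter mem_enum => /andP[/eqP sd sS] Es.
  by move: ni; rewrite Es ffunE; case: (t =P s) => [-> //|_]; rewrite eqxx.
have -> : c = \sum_t c t *: simplex_chain K t.
  apply/ffunP => t; rewrite sum_ffunE (bigD1 t) //= big1 ?addr0 => [|s nst].
    by rewrite !ffunE eqxx; apply/esym/mulr1.
  by rewrite !ffunE eq_sym (negbTE nst) scaler0.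
apply: rpred_sum => t _.
have [->|/supp_c[tS td]] := eqVneq (c t) 0; first by rewrite scale0r mem0v.
apply/rpredZ/memv_span/map_f.
by rewrite mem_filter td eqxx mem_enum.
Qed.

Lemma mem_cycles d S c :
  (c \in cycles K d S) = (c \in chains K d S) && (boundary c == 0).
Proof. by rewrite memv_cap memv_ker lfunE. Qed.

Lemma boundariesP d S c :
  reflect (exists2 b, b \in chains K d.+1 S & c = boundary b)
          (c \in boundaries K d S).
Proof.
by apply: (iffP memv_imgP) => -[b bS ->]; exists b => //; rewrite lfunE.
Qed.

(** The sign of moving v from the front of v |: t to its place in the
    enumeration order. *)
Definition vsign v t : K := (-1) ^+ vertex_pos v t.

Lemma vsign_sqr v t : vsign v t * vsign v t = 1.
Proof. by rewrite -expr2 sqrr_sign. Qed.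

Lemma vertex_posU u v t : u \notin t ->
  vertex_pos v (u |: t) = (vertex_pos v t + (enum_rank u < enum_rank v))%N.
Proof.
move=> ut; rewrite /vertex_pos; case: ltnP => uv.
  rewrite addn1 -add1n.
  have -> : 1%N = (u \notin [set x in t | (enum_rank x < enum_rank v)%N]).
    by rewrite inE (negbTE ut).
  by rewrite -cardsU1; apply: eq_card => x; rewrite !inE; case: eqVneq => [->|].
rewrite addn0; apply: eq_card => x; rewrite !inE.
by case: eqVneq => [->|] //=; rewrite ltnNge uv (negbTE ut).
Qed.

Lemma enum_rank_lt_neq u v : u != v ->
  (enum_rank v < enum_rank u)%N = ~~ (enum_rank u < enum_rank v)%N.
Proof.
move=> uv; rewrite -leqNgt ltn_neqAle; case: eqP => // /ord_inj/enum_rank_inj E.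
by rewrite E eqxx in uv.
Qed.

(** Inserting u and then v, or v and then u, gives opposite signs because
    exactly one of the two vertices precedes the other.  All sign rules for the
    operators below rest on this. *)
Lemma vsign_swap u v t : u != v -> u \notin t -> v \notin t ->
  vsign v (u |: t) * vsign u t = - (vsign u (v |: t) * vsign v t).
Proof.
move=> uv ut vt; rewrite /vsign !vertex_posU // (enum_rank_lt_neq uv) !exprD.
by case: (_ < _)%N; rewrite ?expr1 ?expr0; ring.
Qed.

(** Chains form the exterior algebra on V.  [wedge v] is the left multiplication
    by v and [contract v] is the contraction with the dual basis vector; the
    boundary is a sum of contractions, so that chain maps and homotopies built
    from these operators can be verified with their anticommutation relations. *)
Definition wedge v c : chain :=
  [ffun t : {set V} => if v \in t then vsign v (t :\ v) * c (t :\ v) else 0].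
Definition contract v c : chain :=
  [ffun t : {set V} => if v \in t then 0 else vsign v t * c (v |: t)].

Lemma wedge_is_linear v : linear (wedge v).
Proof.
move=> a c c'; apply/ffunP => t; rewrite !ffunE; case: ifP => _.
  by rewrite mulrDr; congr (_ + _); apply: mulrCA.
by rewrite scaler0 addr0.
Qed.
HB.instance Definition _ v :=
  GRing.isLinear.Build K chain chain *:%R (wedge v) (wedge_is_linear v).

Lemma contract_is_linear v : linear (contract v).
Proof.
move=> a c c'; apply/ffunP => t; rewrite !ffunE; case: ifP => _.
  by rewrite scaler0 addr0.
by rewrite mulrDr; congr (_ + _); apply: mulrCA.
Qed.
HB.instance Definition _ v :=
  GRing.isLinear.Build K chain chain *:%R (contract v) (contract_is_linear v).

Lemma contractC u v c : contract u (contract v c) = - contract v (contract u c).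
Proof.
apply/ffunP => t; rewrite !ffunE !inE eq_sym.
have [->|vu] /= := eqVneq v u; first by case: (u \in t); rewrite ?mulr0 oppr0.
case: (boolP (u \in t)) => ut; case: (boolP (v \in t)) => vt; rewrite ?mulr0 ?oppr0 //.
rewrite (setUCA [set u]) !mulrA.
rewrite [X in X * _]mulrC vsign_swap 1?eq_sym // mulNr.
by rewrite [vsign v t * _]mulrC.
Qed.

Lemma contract_wedge u v c :
  contract u (wedge v c) = c *+ (u == v) - wedge v (contract u c).
Proof.
apply/ffunP => t; rewrite !ffunE !inE.
have [<-|uv] := eqVneq u v.
  case: (boolP (u \in t)) => ut /=.
    by rewrite setD1K // mulrA vsign_sqr mul1r subrr.
  by rewrite setU1K // mulrA vsign_sqr mul1r subr0.
rewrite ffunE sub0r /=.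
case: (boolP (v \in t)) => vt; last first.
  by rewrite mulr0 oppr0 if_same.
case: (boolP (u \in t)) => ut; rewrite ?mulr0 ?oppr0 //.
have -> : (u |: t) :\ v = u |: (t :\ v).
  by apply/setP => x; rewrite !inE; case: eqVneq => // ->; rewrite eq_sym (negbTE uv).
have ut' : u \notin t :\ v by rewrite inE negb_and ut orbT.
rewrite -{1}(setD1K vt) !mulrA -[RHS]mulNr; congr (_ * _).
have swap := vsign_swap (v := v) uv ut' (negbT (setD11 v t)).
have -> : vsign v (u |: t :\ v) =
    - (vsign u (v |: t :\ v) * vsign v (t :\ v)) * vsign u (t :\ v).
  by rewrite -swap -mulrA vsign_sqr mulr1.
by rewrite setD1K // mulrA mulrN mulrA vsign_sqr mul1r mulNr.
Qed.

(** The differential of the augmented complex, in which set0 spans degree -1.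
    Unlike [boundary] it satisfies the operator identities without exception at
    set0. *)
Definition aug_boundary c : chain := \sum_u contract u c.

Lemma boundaryE c t : boundary c t = if t == set0 then 0 else aug_boundary c t.
Proof.
rewrite ffunE; case: ifP => // _.
rewrite /aug_boundary sum_ffunE big_mkcond; apply: eq_bigr => u _ /=.
by rewrite ffunE; case: (u \in t).
Qed.

Lemma aug_boundary_wedge v c :
  aug_boundary (wedge v c) = c - wedge v (aug_boundary c).
Proof.
rewrite /aug_boundary (eq_bigr _ (fun u _ => contract_wedge u v c)).
rewrite sumrB (linear_sum (wedge v)) (bigD1 v) //= eqxx.
by rewrite big1 ?addr0 // => u /negbTE ->.
Qed.

Lemma aug_boundary_contract v c :
  aug_boundary (contract v c) = - contract v (aug_boundary c).
Proof.
rewrite /aug_boundary (linear_sum (contract v)) -sumrN.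
by apply: eq_bigr => u _; rewrite contractC.
Qed.

Lemma aug_boundaryB c c' :
  aug_boundary (c - c') = aug_boundary c - aug_boundary c'.
Proof.
by rewrite /aug_boundary -sumrB; apply: eq_bigr => u _; rewrite linearB.
Qed.

Section Collapse.
Variables v w : V.

(** Writing a chain as v /\ a + b with v in no simplex of a and b, this is the
    chain w /\ a + b: the map induced by sending the vertex v to w. *)
Definition collapse c : chain :=
  c - (wedge v (contract v c) - wedge w (contract v c)).
(** The chain v /\ a + b is sent to w /\ v /\ a, which is the prism between
    v /\ a and w /\ a. *)
Definition collapse_homotopy c : chain := wedge w (wedge v (contract v c)).

Lemma collapse_is_linear : linear collapse.
Proof.
move=> a c c'; rewrite /collapse !linearP /= !scalerBr !opprB !opprD !addrA.
move: (a *: c) (a *: _) (a *: _) => x y z.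
apply/ffunP => t; rewrite !ffunE; ring.
Qed.
HB.instance Definition _ :=
  GRing.isLinear.Build K chain chain *:%R collapse collapse_is_linear.

Lemma aug_boundary_collapse c :
  aug_boundary (collapse c) = collapse (aug_boundary c).
Proof.
rewrite /collapse !aug_boundaryB !aug_boundary_wedge !aug_boundary_contract.
by rewrite !linearN; congr (_ - _); rewrite !opprK opprD addrACA subrr add0r.
Qed.

Lemma aug_boundary_homotopy c :
  aug_boundary (collapse_homotopy c) + collapse_homotopy (aug_boundary c) =
  c - collapse c.
Proof.
rewrite /collapse /collapse_homotopy !aug_boundary_wedge aug_boundary_contract.
by rewrite subKr (linearN (wedge v)) opprK (linearD (wedge w)) opprD addrA subrK.
Qed.

Lemma contract_supp c t : contract v c t != 0 -> v \notin t /\ c (v |: t) != 0.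
Proof.
rewrite ffunE; case: ifP; rewrite ?eqxx // => _ nz; split=> //.
by apply: contraNneq nz => ->; rewrite mulr0.
Qed.

Lemma wedge_supp x c t : wedge x c t != 0 -> x \in t /\ c (t :\ x) != 0.
Proof.
rewrite ffunE; case: ifP; rewrite ?eqxx // => _ nz; split=> //.
by apply: contraNneq nz => ->; rewrite mulr0.
Qed.

Lemma collapse_id c : (forall t, c t != 0 -> v \notin t) -> collapse c = c.
Proof.
move=> no_v; suff c0 : contract v c = 0.
  by rewrite /collapse c0 !(linear0 (wedge _)) subrr subr0.
apply/ffunP => t; rewrite [RHS]ffunE; apply/eqP; apply/negPn/negP.
by move/contract_supp => [_ /no_v]; rewrite setU11.
Qed.

(** [collapse] fixes the component at set0 by which [boundary] and
    [aug_boundary] differ. *)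
Lemma boundary_collapse c : boundary (collapse c) = collapse (boundary c).
Proof.
have bE c' : boundary c' =
    aug_boundary c' - [ffun t => aug_boundary c' t *+ (t == set0)].
  apply/ffunP => t; rewrite boundaryE !ffunE.
  by case: ifP => _; rewrite ?subrr ?subr0.
rewrite !bE linearB aug_boundary_collapse /=; congr (_ - _).
rewrite [RHS]collapse_id => [|t]; last first.
  by rewrite ffunE; case: (t =P set0) => [->|_]; rewrite ?inE ?mulr0n ?eqxx.
apply/ffunP => t; rewrite !ffunE; case: (t =P set0) => [->|_] //.
by rewrite !inE !mulr1n subr0 subr0.
Qed.

(** The augmented boundary of a cycle is supported at set0, where contraction by
    v vanishes; so only one term of the homotopy formula remains. *)
Lemma boundary_homotopy c : boundary c = 0 ->
  boundary (collapse_homotopy c) = c - collapse c.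
Proof.
move=> dc0; have H0 : collapse_homotopy (aug_boundary c) = 0.
  suff contr0 : contract v (aug_boundary c) = 0.
    by rewrite /collapse_homotopy contr0 !linear0.
  apply/ffunP => t; rewrite !ffunE; case: ifP => // _.
  have := boundaryE c (v |: t); rewrite dc0 ffunE.
  have /negbTE -> : v |: t != set0 by apply/set0Pn; exists v; rewrite setU11.
  by move=> <-; rewrite mulr0.
apply/ffunP => t; rewrite boundaryE -[aug_boundary _]addr0 -H0.
rewrite aug_boundary_homotopy; case: (t =P set0) => // ->.
by rewrite /collapse !ffunE !inE subr0 subr0 subrr.
Qed.
End Collapse.

(** * Merging vertices in a fibre *)

Definition pull_cplx (U : finType) (f : V -> U) (S : {set {set U}}) :
    {set {set V}} :=
  [set s : {set V} | f @: s \in S].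

Definition on_vertices (W : {set V}) S : {set {set V}} :=
  [set s in S | s \subset W].

End Chains.

Section Merging.
Variables (K : fieldType) (V U : finType) (f : V -> U).
Notation chain := {ffun {set V} -> K^o}.
Implicit Types (c : chain) (S : {set {set U}}) (W : {set V}).

(** Replacing v by a vertex w of the same fibre does not change the image of
    a simplex under f. *)
Lemma collapse_chains d S W v w c : w \in W -> v != w -> f v = f w ->
  c \in chains K d (on_vertices W (pull_cplx f S)) ->
  collapse v w c \in chains K d (on_vertices (W :\ v) (pull_cplx f S)).
Proof.
move=> wW vw fvw /chainsP cS; apply/chainsP => t ct.
have [vt|vt] := boolP (v \in t).
  move: ct; rewrite /collapse !ffunE !inE vt eqxx /= setD1K // mulrA vsign_sqr mul1r.
  by rewrite vw /= mulr0 if_same subr0 subrr eqxx.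
have [ct0|ct0] := eqVneq (c t) 0; last first.
  have [] := cS _ ct0; rewrite !inE => /andP[-> /subsetP tW] ->; split=> //=.
  apply/subsetP => x xt; rewrite !inE tW // andbT.
  by apply: contraNneq vt => <-.
move: ct; rewrite /collapse !ffunE (negbTE vt) ct0 !sub0r opprK.
case: ifP; rewrite ?eqxx // => wt.
rewrite !inE (negbTE vt) andbF mulf_eq0 negb_or => /andP[_].
rewrite mulf_eq0 negb_or => /andP[_ /cS[]].
rewrite !inE imsetU1 => /andP[fS /subsetP tW] cardt.
have tE : f @: t = f v |: f @: (t :\ w) by rewrite fvw -imsetU1 setD1K.
rewrite tE fS (cardsD1 w t) wt -cardt cardsU1 !inE (negbTE vt) andbF; split=> //=.
apply/subsetP => x xt; rewrite !inE; apply/andP; split.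
  by apply: contraNneq vt => <-.
by have [->//|xw] := eqVneq x w; apply: tW; rewrite !inE xw xt orbT.
Qed.

Lemma homotopy_chains d S W v w c : w \in W -> v != w -> f v = f w ->
  c \in chains K d (on_vertices W (pull_cplx f S)) ->
  collapse_homotopy v w c \in chains K d.+1 (on_vertices W (pull_cplx f S)).
Proof.
move=> wW vw fvw /chainsP cS; apply/chainsP => t.
move=> /wedge_supp[wt] /wedge_supp[]; rewrite !inE => /andP[_ vt].
move=> /contract_supp[_]; rewrite setD1K; last by rewrite !inE vw.
move=> /cS[]; rewrite !inE => /andP[fS /subsetP tW] cardt.
have tE : f @: t = f @: (t :\ w).
  rewrite -{1}(setD1K wt) imsetU1 -fvw; apply/setUidPr.
  by rewrite sub1set imset_f // !inE vw.
rewrite tE fS (cardsD1 w t) wt cardt; split=> //=.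
apply/subsetP => x xt.
by have [->//|xw] := eqVneq x w; apply: tW; rewrite !inE xw xt.
Qed.

Notation fam W S := (on_vertices W (pull_cplx f S)).

Lemma on_verticesS (W W' : {set V}) (T : {set {set V}}) :
  W \subset W' -> on_vertices W T \subset on_vertices W' T.
Proof.
move=> WW'; apply/subsetP => t; rewrite !inE => /andP[-> tW].
exact: subset_trans WW'.
Qed.

Lemma famS W S S' : S \subset S' -> fam W S \subset fam W S'.
Proof.
by move=> /subsetP SS'; apply/subsetP => t; rewrite !inE => /andP[/SS' -> ->].
Qed.

(** [collapse v w] retracts the cycles on W onto those on W :\ v, and it
    preserves and reflects being a boundary because it is homotopic to the
    identity. *)
Lemma collapse_dim d S S' W v w : S \subset S' ->
  w \in W -> v != w -> f v = f w ->
  (\dim (cycles K d (fam W S) :&: boundaries K d (fam W S')) +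
     \dim (cycles K d (fam (W :\ v) S)) =
   \dim (cycles K d (fam (W :\ v) S) :&: boundaries K d (fam (W :\ v) S')) +
     \dim (cycles K d (fam W S)))%N.
Proof.
move=> SS' wW vw fvw.
have Wv_sub T : fam (W :\ v) T \subset fam W T by apply/on_verticesS/subD1set.
apply: (@dim_cap_transfer _ _ _ (linfun (collapse v w))).
  apply/eqP; rewrite eqEsubv; apply/andP; split; apply/subvP => c.
    move=> /memv_imgP[z]; rewrite lfunE /= mem_cycles => /andP[zS /eqP dz] ->.
    by rewrite mem_cycles collapse_chains //= boundary_collapse dz linear0 eqxx.
  move=> cZ; have cE : collapse v w c = c.
    apply: collapse_id => t; move: cZ; rewrite mem_cycles => /andP[/chainsP cS _].
    move/cS => [/[!inE] /andP[_ /subsetP tW] _].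
    by apply/negP => /tW; rewrite !inE eqxx.
  rewrite -cE -[collapse v w c]/(collapse v w c : _) -(lfunE (collapse v w)).
  exact/memv_img/(subvP (cycles_sub _ _ (Wv_sub S))).
move=> z; rewrite mem_cycles lfunE /= => /andP[zS /eqP dz].
apply/boundariesP/boundariesP => -[b bS zE].
  by exists (collapse v w b); rewrite ?collapse_chains // boundary_collapse -zE.
exists (b + collapse_homotopy v w z).
  apply: memvD; first exact: (subvP (chains_sub _ _ (Wv_sub S'))).
  exact/(homotopy_chains wW vw fvw)/(subvP (chains_sub _ _ (famS W SS'))).
by rewrite linearD /= -zE boundary_homotopy // subrKC.
Qed.
End Merging.

(** * Relabelling along a section *)
Section Relabel.
Variables (K : fieldType) (U V : finType) (s : U -> V).
Hypothesis s_inj : injective s.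

Definition order_flip (u v : U) : K :=
  (-1) ^+ (enum_rank u < enum_rank v)%N *
  (-1) ^+ (enum_rank (s u) < enum_rank (s v))%N.

(** The sign of the permutation that sorts the s-image of the enumeration of t:
    a product over pairs of -1 for every pair whose order s reverses. *)
Definition relabel_sign (t : {set U}) : K :=
  \prod_(v in t) \prod_(u in t | (enum_rank u < enum_rank v)%N) order_flip u v.

Lemma order_flipC u v : u != v -> order_flip u v = order_flip v u.
Proof.
move=> uv; rewrite /order_flip (enum_rank_lt_neq uv) (@enum_rank_lt_neq _ (s u)).
  by do 2 case: (_ < _)%N; rewrite /= ?expr1 ?expr0; ring.
by rewrite (inj_eq s_inj).
Qed.

Lemma vsign_prod (W : finType) (v : W) (t : {set W}) :
  vsign K v t = \prod_(u in t) (-1) ^+ (enum_rank u < enum_rank v)%N.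
Proof.
rewrite /vsign /vertex_pos -prodr_const.
under eq_bigl do rewrite inE.
by rewrite big_mkcondr; apply: eq_bigr => u _; case: (_ < _)%N.
Qed.

(** Adding v to t creates the pairs of v with the elements of t, and their signs
    compare the position of v in t with that of s v in s @: t.  This is what makes
    [relabel] commute with the boundary. *)
Lemma relabel_signU1 v (t : {set U}) : v \notin t ->
  relabel_sign (v |: t) = relabel_sign t * (vsign K v t * vsign K (s v) (s @: t)).
Proof.
move=> vt; have nv w : w \in t -> v != w by move=> wt; apply: contraNneq vt => ->.
have inner w : \prod_(u in v |: t | (enum_rank u < enum_rank w)%N) order_flip u w =
    (if (enum_rank v < enum_rank w)%N then order_flip v w else 1) *
    \prod_(u in t | (enum_rank u < enum_rank w)%N) order_flip u w.
  by rewrite !big_mkcondr big_setU1.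
rewrite /relabel_sign big_setU1 // (inner v) ltnn mul1r.
rewrite (eq_bigr _ (fun w _ => inner w)).
rewrite [X in _ * X = _]big_split /= [RHS]mulrC mulrA; congr (_ * _).
have imE : vsign K (s v) (s @: t) =
    \prod_(w in t) (-1) ^+ (enum_rank (s w) < enum_rank (s v))%N.
  by rewrite vsign_prod big_imset //; apply: in2W.
rewrite imE vsign_prod -!big_split big_mkcondr -big_split /=.
apply: eq_bigr => w wt; rewrite -/(order_flip w v) (order_flipC (nv w wt)).
by rewrite (enum_rank_lt_neq (nv w wt)); case: (_ < _)%N; rewrite ?mulr1 ?mul1r.
Qed.

Lemma relabel_sign_sqr t : relabel_sign t * relabel_sign t = 1.
Proof.
rewrite /relabel_sign -big_split big1 //= => v _; rewrite -big_split big1 //= => u _.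
by rewrite /order_flip; do 2 case: (_ < _)%N; rewrite /= ?expr1 ?expr0; ring.
Qed.

Notation chainU := {ffun {set U} -> K^o}.
Notation chainV := {ffun {set V} -> K^o}.

Definition relabel (c : chainV) : chainU :=
  [ffun t : {set U} => relabel_sign t * c (s @: t)].

Lemma relabel_is_linear : linear relabel.
Proof.
move=> a c c'; apply/ffunP => t; rewrite !ffunE mulrDr; congr (_ + _).
exact: mulrCA.
Qed.
HB.instance Definition _ :=
  GRing.isLinear.Build K chainV chainU *:%R relabel relabel_is_linear.

Definition unlabel (c : chainU) : chainV :=
  [ffun t : {set V} => if t \subset codom s
    then relabel_sign (s @^-1: t) * c (s @^-1: t) else 0].

Lemma unlabelK : cancel unlabel relabel.
Proof.
move=> c; apply/ffunP => t; rewrite !ffunE.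
have -> : s @: t \subset codom s.
  by apply/subsetP => _ /imsetP[u _ ->]; apply: codom_f.
have -> : s @^-1: (s @: t) = t.
  by apply/setP => u; rewrite inE mem_imset.
by rewrite mulrA relabel_sign_sqr mul1r.
Qed.

(** [relabel] only sees the simplices inside the image of s; on the chains
    supported there it is a bijection. *)
Definition on_image (c : chainV) := forall t, c t != 0 -> t \subset s @: setT.

Lemma relabel_eq0 c : on_image c -> relabel c = 0 -> c = 0.
Proof.
move=> c_im /ffunP c0; apply/ffunP => t; rewrite ffunE; apply/eqP/negPn/negP => nz.
have tE : t = s @: (s @^-1: t).
  apply/setP => v; apply/idP/imsetP => [vt|[u]]; last by rewrite inE => ? ->.
  have /imsetP[u _ vE] := subsetP (c_im _ nz) v vt.
  by exists u; rewrite // inE -vE.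
have := c0 (s @^-1: t); rewrite !ffunE -tE => /eqP.
rewrite mulf_eq0 (negbTE nz) orbF => /eqP e0.
have := relabel_sign_sqr (s @^-1: t); rewrite e0 mul0r => /esym/eqP.
by rewrite oner_eq0.
Qed.

(** The boundary of c at s @: t sums over vertices outside s @: t; those that are
    not of the form s u contribute nothing because c lives on the image of s. *)
Lemma boundary_relabel c : on_image c -> boundary (relabel c) = relabel (boundary c).
Proof.
move=> c_im; apply/ffunP => t; rewrite !ffunE imset_eq0; case: eqP => _.
  by rewrite mulr0.
rewrite mulr_sumr [RHS](bigID (mem (s @: setT))) /=.
rewrite [X in _ = _ + X]big1 => [|v]; last first.
  move=> /andP[_ vs]; rewrite (_ : c _ = 0) ?scaler0 ?mulr0 //.
  apply/eqP/negPn/negP => /c_im/subsetP/(_ v); rewrite setU11 (negbTE vs).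
  by move/(_ isT).
rewrite addr0 (eq_bigl [in s @: [set u | u \notin t]]) => [|v]; last first.
  apply/andP/imsetP => [[vt /imsetP[u _ vE]]|[u ut ->]].
    by exists u => //; rewrite inE; apply: contraNN vt; rewrite vE; apply: imset_f.
  by rewrite mem_imset // imset_f //; rewrite inE in ut.
rewrite (big_imset _ (in2W s_inj)); under [RHS]eq_bigl do rewrite inE.
apply: eq_bigr => u ut; rewrite ffunE relabel_signU1 // imsetU1.
rewrite -/(vsign K u t) -/(vsign K (s u) (s @: t)).
have sq (x r y z : K) : x * x = 1 -> x * (r * (x * y) * z) = r * (y * z).
  by move=> xx; rewrite -[RHS]mul1r -xx; ring.
exact/sq/vsign_sqr.
Qed.

Lemma on_imageB c c' : on_image c -> on_image c' -> on_image (c - c').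
Proof.
move=> c_im c_im' t; rewrite !ffunE => nz.
have [c0|/c_im //] := eqVneq (c t) 0; apply: c_im'.
by apply: contraNneq nz => c0'; rewrite c0 c0' subrr.
Qed.

Lemma on_image_boundary c : on_image c -> on_image (boundary c).
Proof.
move=> c_im t; rewrite boundaryE; case: ifP => [|_]; first by rewrite eqxx.
rewrite sum_ffunE => nz.
have [v /contract_supp[_ /c_im vt]] : exists v, contract v c t != 0.
  apply/existsP; apply: contraNT nz; rewrite negb_exists => /forallP c0.
  by apply/eqP/big1 => v _; apply/eqP/negPn.
by apply: subset_trans vt; apply: subsetUr.
Qed.

Variable f : V -> U.
Hypothesis sK : cancel s f.
Notation fam S := (on_vertices (s @: setT) (pull_cplx f S)).

Lemma chains_on_image d S c : c \in chains K d (fam S) -> on_image c.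
Proof. by move=> /chainsP cS t /cS[]; rewrite inE => /andP[]. Qed.

Lemma relabel_chains d S c :
  c \in chains K d (fam S) -> relabel c \in chains K d S.
Proof.
move=> /chainsP cS; apply/chainsP => t; rewrite ffunE mulf_eq0 negb_or.
move=> /andP[_ /cS[]]; rewrite !inE card_imset // => /andP[+ _] ->.
by rewrite -imset_comp (eq_imset _ sK) imset_id.
Qed.

Lemma unlabel_chains d S c :
  c \in chains K d S -> unlabel c \in chains K d (fam S).
Proof.
move=> /chainsP cS; apply/chainsP => t; rewrite ffunE.
case: ifP => [/subsetP t_im|_]; last by rewrite eqxx.
rewrite mulf_eq0 negb_or => /andP[_ /cS[]].
have tE : s @: (s @^-1: t) = t.
  apply/setP => v; apply/imsetP/idP => [[u] /[!inE] ut -> //|vt].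
  by have /codomP[u vE] := t_im v vt; exists u; rewrite // inE -vE.
have -> : s @^-1: t = f @: t.
  by rewrite -{2}tE -imset_comp (eq_imset _ sK) imset_id.
rewrite !inE => -> cardt; split; last first.
  by rewrite -cardt -{1}tE card_imset // -{2}tE -imset_comp (eq_imset _ sK) imset_id.
apply/subsetP => v vt.
by have /codomP[u vE] := t_im v vt; apply/imsetP; exists u.
Qed.

Lemma relabel_dim d S S' :
  (\dim (cycles K d (fam S) :&: boundaries K d (fam S')) + \dim (cycles K d S) =
   \dim (cycles K d S :&: boundaries K d S') + \dim (cycles K d (fam S)))%N.
Proof.
apply: (@dim_cap_transfer _ _ _ (linfun relabel)).
  apply/eqP; rewrite eqEsubv; apply/andP; split; apply/subvP => c.
    move=> /memv_imgP[z]; rewrite lfunE /= mem_cycles => /andP[zS /eqP dz] ->.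
    rewrite mem_cycles relabel_chains // boundary_relabel ?dz ?linear0 ?eqxx //.
    exact: chains_on_image zS.
  rewrite mem_cycles => /andP[/unlabel_chains cS /eqP dc].
  rewrite -(unlabelK c) -(lfunE relabel) memv_img // mem_cycles cS /=.
  have im_c := chains_on_image cS; apply/eqP/relabel_eq0.
    exact: on_image_boundary.
  by rewrite -boundary_relabel // unlabelK.
move=> z; rewrite mem_cycles lfunE /= => /andP[zS _].
apply/boundariesP/boundariesP => -[b bS zE].
  exists (relabel b); rewrite ?relabel_chains // zE boundary_relabel //.
  exact: chains_on_image bS.
exists (unlabel b); first exact: unlabel_chains.
have im_b := chains_on_image (unlabel_chains bS).
apply/eqP; rewrite -subr_eq0; apply/eqP/relabel_eq0.
  exact/on_imageB/on_image_boundary/im_b/(chains_on_image zS).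
by rewrite linearB /= zE -boundary_relabel // unlabelK subrr.
Qed.

End Relabel.

(** A vertex v outside the image of the section s can be merged into s (f v),
    which lies in the same fibre.  Once all of them are merged, what is left is
    a relabelled copy of the complex downstairs. *)
Lemma pull_cplx_dim (K : fieldType) (U V : finType) (f : V -> U) (s : U -> V)
    d (S S' : {set {set U}}) : cancel s f -> S \subset S' ->
  (\dim (cycles K d (pull_cplx f S) :&: boundaries K d (pull_cplx f S')) +
     \dim (cycles K d S) =
   \dim (cycles K d S :&: boundaries K d S') +
     \dim (cycles K d (pull_cplx f S)))%N.
Proof.
move=> sK SS'; have s_inj := can_inj sK.
suff main (W : {set V}) : s @: setT \subset W ->
    (\dim (cycles K d (on_vertices W (pull_cplx f S)) :&:
             boundaries K d (on_vertices W (pull_cplx f S'))) +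
       \dim (cycles K d S) =
     \dim (cycles K d S :&: boundaries K d S') +
       \dim (cycles K d (on_vertices W (pull_cplx f S))))%N.
  have := main setT (subsetT _).
  have onT T : on_vertices setT (pull_cplx f T) = pull_cplx f T.
    by apply/setP => t; rewrite !inE subsetT andbT.
  by rewrite !onT.
have [n] := ubnP #|W :\: s @: setT|; elim: n W => // n IHn W; rewrite ltnS => Wn sW.
have [W0|[v]] := set_0Vmem (W :\: s @: setT).
  have -> : W = s @: setT.
    by apply/eqP; rewrite eqEsubset sW andbT -setD_eq0 W0.
  exact: relabel_dim.
rewrite inE => /andP[vs vW].
have sW' : s @: setT \subset W :\ v by rewrite subsetD1 sW.
have wW : s (f v) \in W by apply: (subsetP sW); apply: imset_f.
have vw : v != s (f v) by apply: contraNneq vs => ->; apply: imset_f.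
have fvw : f v = f (s (f v)) by rewrite sK.
have := IHn (W :\ v) _ sW'; have := collapse_dim K d SS' wW vw fvw.
move: (\dim _) (\dim _) (\dim _) (\dim _) (\dim _) (\dim _) => a b c e g h.
have card_lt : (#|(W :\ v) :\: s @: setT| < n)%N.
  apply: leq_trans Wn; apply/proper_card/properP; split.
    exact/setSD/subD1set.
  by exists v; rewrite !inE ?eqxx ?andbF // vs vW.
by move=> + /(_ card_lt); lia.
Qed.

(** * Weighted norms *)

Section WeightedNorm.
Variable R : realType.

Lemma pushforward_ge0 (S T : finType) (f : S -> T) (mu : S -> R) t :
  (forall s, 0 <= mu s) -> 0 <= pushforward f mu t.
Proof. by move=> mu0; apply: sumr_ge0. Qed.

Lemma sum_pushforward (S T : finType) (f : S -> T) (mu : S -> R) (F : T -> R) :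
  \sum_t F t * pushforward f mu t = \sum_s F (f s) * mu s.
Proof.
rewrite [RHS](partition_big f xpredT) //=; apply: eq_bigr => t _.
by rewrite /pushforward mulr_sumr; apply: eq_bigr => s /eqP ->.
Qed.

Lemma pushforward_posP (S T : finType) (f : S -> T) (mu : S -> R) t :
  (forall s, 0 <= mu s) ->
  reflect (exists2 s, f s = t & 0 < mu s) (0 < pushforward f mu t).
Proof.
move=> mu0; apply: (iffP idP) => [|[s fs mus]]; last first.
  rewrite /pushforward (bigD1 s) ?fs //=.
  by apply: ltr_wpDr => //; apply: sumr_ge0.
rewrite lt0r psumr_eq0 // => /andP[/allPn[s _]].
rewrite negb_imply => /andP[/eqP fs nz] _.
by exists s => //; rewrite lt0r nz mu0.
Qed.

Lemma pushforward_comp (S T U : finType) (f : S -> T) (g : T -> U) (mu : S -> R) :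
  pushforward g (pushforward f mu) =1 pushforward (g \o f) mu.
Proof.
move=> u; rewrite /pushforward [RHS](partition_big f (fun t => g t == u)) //=.
apply: eq_bigr => t /eqP gt; apply: eq_bigl => s.
by case: (eqVneq (f s) t) => [->|]; rewrite ?gt ?eqxx ?andbF.
Qed.

Lemma eq_pushforward (S T : finType) (f g : S -> T) (mu nu : S -> R) :
  f =1 g -> mu =1 nu -> pushforward f mu =1 pushforward g nu.
Proof.
by move=> fg mn t; apply: eq_big => [s|s _]; rewrite ?fg.
Qed.

Lemma prod_mass_pushforward (S S' T T' : finType) (f : S -> T) (g : S' -> T')
    (mu : S -> R) (nu : S' -> R) :
  prod_mass (pushforward f mu) (pushforward g nu) =1
  pushforward (fun u => (f u.1, g u.2)) (prod_mass mu nu).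
Proof.
move=> [t t']; rewrite /prod_mass /pushforward /= big_distrlr pair_big /=.
by apply: eq_bigl => -[s s'] /=; rewrite xpair_eqE.
Qed.

Lemma pushforward_fst (S T : finType) (mu : S -> R) (nu : T -> R) :
  \sum_t nu t = 1 -> pushforward fst (prod_mass mu nu) =1 mu.
Proof.
move=> nu1 s; rewrite /pushforward.
rewrite (eq_bigl (fun u => pred1 s u.1 && xpredT u.2)) => [|u]; last by rewrite andbT.
rewrite -(pair_big (pred1 s) xpredT (fun s t => mu s * nu t)) /= big_pred1_eq.
by rewrite -mulr_sumr nu1 mulr1.
Qed.

Lemma pushforward_snd (S T : finType) (mu : S -> R) (nu : T -> R) :
  \sum_s mu s = 1 -> pushforward snd (prod_mass mu nu) =1 nu.
Proof.
move=> mu1 t; rewrite /pushforward.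
rewrite (eq_bigl (fun u => xpredT u.1 && pred1 t u.2)) => [|u]; last by [].
rewrite -(pair_big xpredT (pred1 t) (fun s t => mu s * nu t)) exchange_big /=.
by rewrite big_pred1_eq -mulr_suml mu1 mul1r.
Qed.

(** With the maximum for p = +oo taken over the support of mu, the norm is
    invariant under change of variables for every p.  The distortion and the costs
    of both kinds of morphisms are norms of this form. *)
Definition wnorm (I : finType) (p : \bar R) (mu f : I -> R) : R :=
  pnorm p (fun i => 0 < mu i) mu f.

Lemma pnorm_wnorm (I : finType) (p : \bar R) (A : pred I) (mu f : I -> R) :
  A =1 (fun i => 0 < mu i) -> pnorm p A mu f = wnorm p mu f.
Proof. by move=> AE; rewrite /wnorm /pnorm; case: p => // ; apply: eq_bigl. Qed.

Lemma eq_wnorm (I : finType) (p : \bar R) (mu nu f g : I -> R) :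
  mu =1 nu -> f =1 g -> wnorm p mu f = wnorm p nu g.
Proof.
move=> mn fg; rewrite /wnorm /pnorm; case: p => [r||].
- by congr (_ `^ _); apply: eq_bigr => i _; rewrite mn fg.
- by apply: eq_big => [i|i _]; rewrite ?mn ?fg.
- by apply: eq_big => [i|i _]; rewrite ?mn ?fg.
Qed.

Lemma wnorm_pushforward (S T : finType) p (f : S -> T) (mu : S -> R) (F : T -> R) :
  (forall s, 0 <= mu s) -> wnorm p (pushforward f mu) F = wnorm p mu (F \o f).
Proof.
move=> mu0; rewrite /wnorm /pnorm; case: p => [r||].
- by rewrite (sum_pushforward f mu (fun t => `|F t| `^ r)).
all: apply/eqP; rewrite eq_le; apply/andP; split; apply/bigmax_leP; split.
all: try by apply: bigmax_ge_id.
all: try by move=> t /pushforward_posP[//|s <- mus]; apply: le_bigmax_cond.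
all: move=> s mus; apply: (le_bigmax_cond _ (fun t => `|F t|)).
all: by apply/pushforward_posP => //; exists s.
Qed.

Lemma powR_convex (x y a b r : R) : 0 <= x -> 0 <= y -> 0 <= a -> 0 <= b ->
  a + b = 1 -> 1 <= r -> (a * x + b * y) `^ r <= a * x `^ r + b * y `^ r.
Proof.
move=> x0 y0 a0 b0 ab1 r1.
have bE : b = 1 - a by rewrite -ab1 addrAC subrr add0r.
have a1 : a <= 1 by rewrite -subr_ge0 -bE.
rewrite bE; apply: (hoelder.convex_powR r1 (interval_inference.Itv01 a0 a1)).
  by apply/classical_sets.mem_set; rewrite /= in_itv /= x0.
by apply/classical_sets.mem_set; rewrite /= in_itv /= y0.
Qed.

Section Exponent.
Variable p : \bar R.
Hypothesis p1 : (1%:E <= p)%E.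

Lemma wnorm_ge0 (I : finType) (mu f : I -> R) : 0 <= wnorm p mu f.
Proof.
by case: p => [r||]; rewrite /wnorm /pnorm; [exact: powR_ge0|exact: bigmax_ge_id..].
Qed.

(** For finite p, the p-th power of |f| is at most the sum over k of that of
    |g o pi k|, and each of the n summands has the same integral as that of |g|. *)
Lemma ler_wnorm_family (I J : finType) n (pi : 'I_n -> I -> J) (mu : I -> R)
    (nu : J -> R) f g : (forall i, 0 <= mu i) ->
  (forall j, 0 <= nu j) -> (forall k, pushforward (pi k) mu =1 nu) ->
  (forall i, exists k, `|f i| <= `|g (pi k i)|) ->
  wnorm p mu f <= n%:R `^ exponent_inv p * wnorm p nu g.
Proof.
move=> mu0 nu0 pi_mu fg.
rewrite /wnorm /pnorm /exponent_inv; case: p p1 => [r|_|//]; last first.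
  rewrite powRr0 mul1r; apply/bigmax_leP; split; first exact: bigmax_ge_id.
  move=> i mui; have [k /le_trans -> //] := fg i.
  apply: (le_bigmax_cond _ (fun j => `|g j|)).
  by rewrite -(pi_mu k); apply/pushforward_posP => //; exists i.
rewrite lee_fin => r1; have r0 : 0 < r by apply: lt_le_trans r1.
have sum_ge0 (J' : finType) (nu' : J' -> R) h : (forall j, 0 <= nu' j) ->
    0 <= \sum_j `|h j| `^ r * nu' j.
  by move=> nu'0; apply: sumr_ge0 => j _; rewrite mulr_ge0 ?powR_ge0.
rewrite -powRM ?ler0n ?sum_ge0 //.
rewrite ge0_ler_powR ?nnegrE ?invr_ge0 ?mulr_ge0 ?sum_ge0 ?(ltW r0) //.
have -> : n%:R * \sum_j `|g j| `^ r * nu j =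
    \sum_i \sum_(k < n) `|g (pi k i)| `^ r * mu i.
  rewrite exchange_big /= mulr_natl -[in LHS](card_ord n) -sumr_const.
  apply: eq_bigr => k _; rewrite -(sum_pushforward (pi k) mu (fun j => `|g j| `^ r)).
  by apply: eq_bigr => j _; rewrite pi_mu.
apply: ler_sum => i _; have [k fgk] := fg i.
rewrite (bigD1 k) //=; apply: ler_wpDr.
  by apply: sumr_ge0 => j _; rewrite mulr_ge0 ?powR_ge0.
rewrite ler_wpM2r // ge0_ler_powR ?nnegrE ?normr_ge0 // ltW //.
Qed.

Lemma ler_wnorm (I : finType) (mu f g : I -> R) : (forall i, 0 <= mu i) ->
  (forall i, `|f i| <= `|g i|) -> wnorm p mu f <= wnorm p mu g.
Proof.
move=> mu0 fg; have := @ler_wnorm_family I I 1 (fun=> id) mu mu f g mu0 mu0 _ _.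
rewrite powR1 mul1r; apply=> [_ i|i]; last by exists ord0.
by rewrite /pushforward big_pred1_eq.
Qed.

Lemma wnormZ (I : finType) (mu f : I -> R) a : (forall i, 0 <= mu i) ->
  wnorm p mu (fun i => a * f i) = `|a| * wnorm p mu f.
Proof.
move=> mu0; rewrite /wnorm /pnorm; case: p p1 => [r|_|//]; last first.
  under eq_bigr do rewrite normrM.
  have maxM : {morph *%R `|a| : x y / Num.max x y} by move=> x y; rewrite maxr_pMr.
  by rewrite -(big_morph _ maxM (mulr0 _)).
rewrite lee_fin => r1; have r0 : 0 < r by apply: lt_le_trans r1.
under eq_bigr do rewrite normrM powRM // -mulrA.
rewrite -mulr_sumr powRM ?powR_ge0 //.
  by rewrite -powRrM mulfV ?gt_eqF // powRr1.
by apply: sumr_ge0 => i _; rewrite mulr_ge0 ?powR_ge0.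
Qed.

(** Minkowski's inequality.  If A and B are positive upper bounds of the two
    norms, convexity of x `^ r at |f| / A and |g| / B with weights A / (A + B) and
    B / (A + B) bounds the norm of the sum by A + B.  Approaching the norms from
    above covers the case in which one of them vanishes. *)
Lemma ler_wnormD (I : finType) (mu f g : I -> R) : (forall i, 0 <= mu i) ->
  wnorm p mu (fun i => f i + g i) <= wnorm p mu f + wnorm p mu g.
Proof.
move=> mu0; rewrite /wnorm /pnorm; case: p p1 => [r|_|//]; last first.
  apply/bigmax_leP; split=> [|i mui]; first by rewrite addr_ge0 ?bigmax_ge_id.
  apply: le_trans (ler_normD _ _) _; apply: lerD.
    exact: (le_bigmax_cond _ (fun i => `|f i|)).
  exact: (le_bigmax_cond _ (fun i => `|g i|)).
rewrite lee_fin => r1; have r0 : 0 < r by apply: lt_le_trans r1.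
pose S (h : I -> R) := \sum_i `|h i| `^ r * mu i.
have S_ge0 h : 0 <= S h by apply: sumr_ge0 => i _; rewrite mulr_ge0 ?powR_ge0.
have S_le h A : 0 < A -> S h `^ r^-1 <= A -> S h <= A `^ r.
  move=> A0 SA; have -> : S h = (S h `^ r^-1) `^ r.
    by rewrite -powRrM mulVf ?gt_eqF // powRr1.
  by rewrite ge0_ler_powR ?nnegrE ?powR_ge0 // ltW.
have main A B : 0 < A -> 0 < B -> S f `^ r^-1 <= A -> S g `^ r^-1 <= B ->
    S (fun i => f i + g i) `^ r^-1 <= A + B.
  move=> A0 B0 /(S_le _ _ A0) fA /(S_le _ _ B0) gB.
  have AB0 : 0 < A + B by apply: addr_gt0.
  have -> : A + B = ((A + B) `^ r) `^ r^-1.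
    by rewrite -powRrM mulfV ?gt_eqF // powRr1 // ltW.
  rewrite ge0_ler_powR ?nnegrE ?invr_ge0 ?powR_ge0 ?(ltW r0) //.
  pose a := A / (A + B); pose b := B / (A + B).
  have ab1 : a + b = 1 by rewrite /a /b -mulrDl mulfV ?gt_eqF.
  have a0 : 0 <= a by rewrite divr_ge0 ?ltW.
  have b0 : 0 <= b by rewrite divr_ge0 ?ltW.
  apply: (@le_trans _ _
    ((A + B) `^ r * (a * (S f / A `^ r) + b * (S g / B `^ r)))); last first.
    rewrite -[leRHS]mulr1 ler_wpM2l ?powR_ge0 // -ab1 lerD //.
      by rewrite -[leRHS]mulr1 ler_wpM2l // ler_pdivrMr ?mul1r // powR_gt0.
    by rewrite -[leRHS]mulr1 ler_wpM2l // ler_pdivrMr ?mul1r // powR_gt0.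
  have -> : (A + B) `^ r * (a * (S f / A `^ r) + b * (S g / B `^ r)) =
      \sum_i (A + B) `^ r * (a * (`|f i| / A) `^ r + b * (`|g i| / B) `^ r) * mu i.
    rewrite /S !mulr_suml !mulr_sumr -big_split mulr_sumr /=; apply: eq_bigr => i _.
    rewrite !powRM ?invr_ge0 ?(ltW A0) ?(ltW B0) //.
    have invE x : 0 < x -> x^-1 `^ r = (x `^ r)^-1.
      by move=> x0; rewrite -(powR_inv1 (ltW x0)) -powRrM mulN1r powRN.
    by rewrite !invE //; ring.
  apply: ler_sum => i _; rewrite ler_wpM2r //.
  have -> : `|f i + g i| `^ r = (A + B) `^ r * (`|f i + g i| / (A + B)) `^ r.
    by rewrite -powRM ?divr_ge0 ?(ltW AB0) // mulrCA mulfV ?gt_eqF // mulr1.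
  rewrite ler_wpM2l ?powR_ge0 //.
  have fA0 : 0 <= `|f i| / A by rewrite divr_ge0 // ltW.
  have gB0 : 0 <= `|g i| / B by rewrite divr_ge0 // ltW.
  apply: le_trans (powR_convex fA0 gB0 a0 b0 ab1 r1).
  rewrite ge0_ler_powR ?nnegrE ?(ltW r0) ?addr_ge0 ?mulr_ge0 ?invr_ge0
    ?(ltW A0) ?(ltW B0) ?(ltW AB0) //.
  rewrite ler_pdivrMr // mulrDl.
  rewrite (_ : a * _ * _ = `|f i|) 1?(_ : b * _ * _ = `|g i|) ?ler_normD //.
    by rewrite /b; field; rewrite ?gt_eqF.
  by rewrite /a; field; rewrite ?gt_eqF.
apply/ler_addgt0Pl => e e0; rewrite -/(S _) -/(S f) -/(S g).
have e2 : 0 < e / 2 by rewrite divr_gt0.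
have -> : e + (S f `^ r^-1 + S g `^ r^-1) = (e/2 + S f `^ r^-1) + (e/2 + S g `^ r^-1).
  by rewrite [in LHS](splitr e) addrACA.
by apply: main; rewrite ?ler_wpDl ?ltr_pwDl ?powR_ge0 // ltW.
Qed.
End Exponent.
End WeightedNorm.

(** * Couplings and zigzags *)

Section Couplings.
Variables (R : realType) (p : \bar R).
Hypothesis p1 : (1%:E <= p)%E.
Implicit Types X Y Z : mmSpace R.

Lemma prod_mass_ge0 (S T : finType) (mu : S -> R) (nu : T -> R) u :
  (forall s, 0 <= mu s) -> (forall t, 0 <= nu t) -> 0 <= prod_mass mu nu u.
Proof. by move=> mu0 nu0; apply: mulr_ge0. Qed.

Lemma distortion_wnorm X Y (mu : X * Y -> R) : (forall u, 0 <= mu u) ->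
  distortion p mu = wnorm p (prod_mass mu mu)
    (fun u => dist u.1.1 u.2.1 - dist u.1.2 u.2.2).
Proof.
move=> mu0; apply: pnorm_wnorm => u; rewrite /prod_mass.
by rewrite !lt0r mulf_eq0 negb_or !mu0 mulr_ge0 ?mu0 // !andbT.
Qed.

Lemma mm_cost_wnorm X Y (f : mm_hom X Y) :
  mm_cost p f = wnorm p (prod_mass (@mass R X) (@mass R X))
    (fun u => dist u.1 u.2 - dist (f u.1) (f u.2)).
Proof.
by apply: pnorm_wnorm => u; rewrite /prod_mass mulr_gt0 ?mass_gt0.
Qed.

Lemma big_fst (S T : finType) (F : S * T -> R) s :
  \sum_(u | u.1 == s) F u = \sum_t F (s, t).
Proof.
rewrite (reindex (fun t => (s, t))) /=; first by under eq_bigl do rewrite eqxx.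
by exists snd => [//|[s' t] /eqP /= ->].
Qed.

Lemma big_snd (S T : finType) (F : S * T -> R) t :
  \sum_(u | u.2 == t) F u = \sum_s F (s, t).
Proof.
rewrite (reindex (fun s => (s, t))) /=; first by under eq_bigl do rewrite eqxx.
by exists fst => [//|[s t'] /eqP /= ->].
Qed.

(** Two mass-preserving maps out of a common space determine a coupling, whose
    distortion can be computed upstairs. *)
Lemma coupling_of_maps (T : finType) (m : T -> R) X Y (a : T -> X) (b : T -> Y) :
  (forall t, 0 <= m t) -> pushforward a m =1 @mass R X ->
  pushforward b m =1 @mass R Y ->
  exists2 mu : X * Y -> R, is_coupling mu &
    distortion p mu = wnorm p (prod_mass m m)
      (fun u => dist (a u.1) (a u.2) - dist (b u.1) (b u.2)).
Proof.
move=> m0 am bm; pose mu := pushforward (fun t => (a t, b t)) m.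
have mu0 u : 0 <= mu u by apply: pushforward_ge0.
exists mu; first split=> //.
- by move=> x; rewrite -am -(big_fst mu) -/(pushforward _ _ _) pushforward_comp.
- by move=> y; rewrite -bm -(big_snd mu) -/(pushforward _ _ _) pushforward_comp.
rewrite distortion_wnorm // (eq_wnorm _ (prod_mass_pushforward _ _ _ _) (frefl _)).
by rewrite wnorm_pushforward // => u; apply: prod_mass_ge0.
Qed.

(** On X * Y * Z let x and z be independent given y.  Both couplings are marginals
    of this mass, and the distortion of the X * Z marginal is the norm of the sum
    of the two integrands. *)
Lemma coupling_glue X Y Z (mu : X * Y -> R) (nu : Y * Z -> R) :
  is_coupling mu -> is_coupling nu ->
  exists2 pi : X * Z -> R, is_coupling pi &
    distortion p pi <= distortion p mu + distortion p nu.
Proof.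
move=> [mu0 muX muY] [nu0 nuY nuZ].
(* Conditioning on y divides by its mass, which is the marginal of both couplings. *)
pose tau (t : (X * Y) * Z) := mu t.1 * nu (t.1.2, t.2) / mass t.1.2.
have tau0 t : 0 <= tau t by rewrite mulr_ge0 ?mulr_ge0 // invr_ge0 ltW ?mass_gt0.
pose yz (t : (X * Y) * Z) := (t.1.2, t.2).
have tau_mu : pushforward fst tau =1 mu.
  move=> [x y]; rewrite /pushforward big_fst /tau /= -mulr_suml -mulr_sumr nuY.
  by rewrite mulfK // gt_eqF ?mass_gt0.
have tau_nu : pushforward yz tau =1 nu.
  move=> [y z]; rewrite /pushforward (reindex (fun x => ((x, y), z))) /=; last first.
    by exists (fun t => t.1.1) => [//|[[x y'] z'] /eqP[-> ->]].
  under eq_bigl do rewrite eqxx.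
  by rewrite /tau /= -mulr_suml -mulr_suml muY mulrAC mulfV ?mul1r // gt_eqF ?mass_gt0.
have [||pi pi_cpl pi_dist] := @coupling_of_maps _ tau X Z (fun t => t.1.1) snd tau0.
- move=> x; rewrite -muX -(big_fst mu) -/(pushforward _ _ _).
  by rewrite -(eq_pushforward (frefl _) tau_mu) pushforward_comp.
- move=> z; rewrite -nuZ -(big_snd nu) -/(pushforward _ _ _).
  by rewrite -(eq_pushforward (frefl _) tau_nu) pushforward_comp.
exists pi => //; rewrite pi_dist !distortion_wnorm //.
have tt0 u : 0 <= prod_mass tau tau u by apply: prod_mass_ge0.
have mumu u : prod_mass mu mu u =
    pushforward (fun u => (u.1.1, u.2.1)) (prod_mass tau tau) u.
  by rewrite -prod_mass_pushforward /prod_mass !tau_mu.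
have nunu u : prod_mass nu nu u =
    pushforward (fun u => (yz u.1, yz u.2)) (prod_mass tau tau) u.
  by rewrite -prod_mass_pushforward /prod_mass !tau_nu.
rewrite (eq_wnorm _ mumu (frefl _)) (eq_wnorm _ nunu (frefl _)).
rewrite !wnorm_pushforward //; apply: le_trans (ler_wnormD p1 _ _ tt0).
by apply: (ler_wnorm p1) => // u /=; rewrite addrA subrK.
Qed.

(** A single morphism f : X -> Y, read in either direction, is the coupling given
    by its graph; longer zigzags are glued. *)
Lemma zigzag_coupling X Y (P : zigzag (@mm_hom R) X Y) :
  exists2 mu : X * Y -> R, is_coupling mu &
    distortion p mu <= zigzag_cost (mm_cost p) P.
Proof.
have step_coupling A B (s : step (@mm_hom R) A B) :
    exists2 mu : A * B -> R, is_coupling mu &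
      distortion p mu <= step_cost (mm_cost p) s.
  have id_mass A' : pushforward id (@mass R A') =1 @mass R A'.
    by move=> x; rewrite /pushforward big_pred1_eq.
  have mass0 (A' : mmSpace R) (x : A') : 0 <= mass x by exact/ltW/mass_gt0.
  case: s => f /=; rewrite mm_cost_wnorm.
    have [mu cpl mu_dist] := coupling_of_maps (@mass0 A) (id_mass A) (mm_fun_mass f).
    by exists mu => //; rewrite mu_dist.
  have [mu cpl mu_dist] := coupling_of_maps (@mass0 B) (mm_fun_mass f) (id_mass B).
  exists mu => //; rewrite mu_dist; apply: ler_wnorm => // u.
    exact: prod_mass_ge0.
  by rewrite distrC.
elim: P => [A B s|A B C s P [nu nu_cpl nuP]] /=; first exact: step_coupling.
have [mu mu_cpl mus] := step_coupling _ _ s.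
have [pi pi_cpl piE] := coupling_glue mu_cpl nu_cpl.
by exists pi => //; apply: le_trans piE _; apply: lerD.
Qed.

End Couplings.

Section Reach.
Variables (R : realType) (Ob : Type) (Hom : Ob -> Ob -> Type).
Variable cost : forall A B : Ob, Hom A B -> R.

Definition reach A B (c : R) : Prop :=
  exists P : zigzag Hom A B, zigzag_cost cost P <= c.

Fixpoint zigzag_cat A B C (P : zigzag Hom A B) : zigzag Hom B C -> zigzag Hom A C :=
  match P with
  | ZOne _ _ s => ZCons s
  | ZCons _ _ _ s P' => fun Q => ZCons s (zigzag_cat P' Q)
  end.

Lemma zigzag_cat_cost A B C (P : zigzag Hom A B) (Q : zigzag Hom B C) :
  zigzag_cost cost (zigzag_cat P Q) = zigzag_cost cost P + zigzag_cost cost Q.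
Proof. by elim: P Q => [A' B' s|A' B' C' s P IHP] Q //=; rewrite IHP addrA. Qed.

Lemma reach_trans A B C c c' : reach A B c -> reach B C c' -> reach A C (c + c').
Proof.
move=> [P Pc] [Q Qc]; exists (zigzag_cat P Q).
by rewrite zigzag_cat_cost lerD.
Qed.
End Reach.

Lemma count_ltn (T : eqType) (a b : pred T) (s : seq T) x :
  x \in s -> subpred a b -> ~~ a x -> b x -> (count a s < count b s)%N.
Proof.
move=> xs ab nax bx.
rewrite (permP (perm_to_rem xs) a) (permP (perm_to_rem xs) b) /= bx (negbTE nax).
by rewrite ltnS sub_count.
Qed.

(** * Interpolating between the projections of a coupling *)

Section Interpolation.
Variables (R : realType) (p : \bar R).
Hypothesis p1 : (1%:E <= p)%E.
Variables (X Y : mmSpace R) (mu : X * Y -> R).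
Hypothesis mu_cpl : is_coupling mu.

Let mu0 u : 0 <= mu u. Proof. by case: mu_cpl. Qed.

Definition coupling_supp : finType := {u : X * Y | 0 < mu u}.

Definition supp_mass (z : coupling_supp) : R := mu (val z).

Lemma supp_mass_gt0 z : 0 < supp_mass z. Proof. exact: (valP z). Qed.

Lemma pushforward_supp_mass :
  pushforward (val : coupling_supp -> X * Y) supp_mass =1 mu.
Proof.
move=> u; rewrite /pushforward; have [mu_u|] := ltP 0 (mu u).
  rewrite (big_pred1 (Sub u mu_u : coupling_supp)) => [|z].
    by rewrite /supp_mass SubK.
  by rewrite /= -[RHS](inj_eq val_inj).
move=> mu_u; rewrite big_pred0 => [|z].
  by apply/eqP; rewrite eq_le mu0 mu_u.
by apply/negbTE/eqP => zu; have := valP z; rewrite zu ltNge mu_u.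
Qed.

Lemma supp_mass_sum : \sum_z supp_mass z = 1.
Proof.
rewrite -(pushforward_sum (val : coupling_supp -> X * Y)).
rewrite (eq_bigr _ (fun u _ => pushforward_supp_mass u)).
rewrite -(pushforward_sum (fst : X * Y -> X)) -(mass_sum X).
by apply: eq_bigr => x _; rewrite /pushforward big_fst; case: mu_cpl.
Qed.

(** The convex combination of the two distances, pulled back to the support of
    the coupling; a metric for 0 < t < 1. *)
Definition interp_dist (t : R) (a b : coupling_supp) : R :=
  (1 - t) * dist (val a).1 (val b).1 + t * dist (val a).2 (val b).2.

Section Interior.
Variable t : R.
Hypothesis t01 : 0 < t < 1.

Lemma interp_dist_eq0 a b : interp_dist t a b = 0 <-> a = b.
Proof.
have /andP[t0 t1] := t01; rewrite -subr_gt0 in t1; split=> [|->]; last first.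
  by rewrite /interp_dist !(proj2 (dist_eq0 _ _)) // !mulr0 addr0.
move/eqP; rewrite /interp_dist paddr_eq0 ?mulr_ge0 ?dist_ge0 ?ltW //.
rewrite !mulf_eq0 (gt_eqF t0) (gt_eqF t1) /=.
move=> /andP[/eqP/dist_eq0 e1 /eqP/dist_eq0 e2].
exact/val_inj/injective_projections.
Qed.

Lemma interp_dist_sym a b : interp_dist t a b = interp_dist t b a.
Proof. by rewrite /interp_dist !(dist_sym (val b).1, dist_sym (val b).2). Qed.

Lemma interp_dist_triangle a b c :
  interp_dist t a c <= interp_dist t a b + interp_dist t b c.
Proof.
have /andP[/ltW t0 /ltW t1] := t01; rewrite -subr_ge0 in t1.
rewrite /interp_dist addrACA -!mulrDr.
by apply: lerD; apply: ler_wpM2l; rewrite // dist_triangle.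
Qed.

Definition interp_space : mmSpace R :=
  MMSpace interp_dist_eq0 interp_dist_sym interp_dist_triangle
    supp_mass_gt0 supp_mass_sum.
End Interior.

(** W is the quotient of the support, with its mass, on which [interp_dist t]
    becomes a metric.  This covers 0 < t < 1, where the quotient map is bijective,
    together with the two ends, where the quotients are X and Y. *)
Definition realizes (t : R) (W : mmSpace R) (pi : coupling_supp -> W) : Prop :=
  pushforward pi supp_mass =1 @mass R W /\
  forall a b, dist (pi a) (pi b) = interp_dist t a b.

Lemma realizes0 : realizes 0 (fun z => (val z).1 : X).
Proof.
split=> [x|a b]; last by rewrite /interp_dist subr0 mul1r mul0r addr0.
case: mu_cpl => _ <- _; rewrite -(big_fst mu) -/(pushforward _ _ _).
by rewrite -(eq_pushforward (frefl _) pushforward_supp_mass) pushforward_comp.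
Qed.

Lemma realizes1 : realizes 1 (fun z => (val z).2 : Y).
Proof.
split=> [x|a b]; last by rewrite /interp_dist subrr mul1r mul0r add0r.
case: mu_cpl => _ _ <-; rewrite -(big_snd mu) -/(pushforward _ _ _).
by rewrite -(eq_pushforward (frefl _) pushforward_supp_mass) pushforward_comp.
Qed.

(** The integrand of the cost is the difference of [interp_dist t] and
    [interp_dist s], which is t - s times the difference of the distances of Y and
    X. *)
Lemma interp_hom (t s : R) (t01 : 0 < t < 1) (W : mmSpace R) (pi : coupling_supp -> W) :
  realizes s pi ->
  (forall a b a' b', interp_dist t a b <= interp_dist t a' b' ->
     interp_dist s a b <= interp_dist s a' b') ->
  exists f : mm_hom (interp_space t01) W,
    mm_cost p f = `|t - s| * distortion p mu.
Proof.
move=> [pi_mass pi_dist] mono.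
have order (a b a' b' : interp_space t01) : dist a b <= dist a' b' ->
    dist (pi a) (pi b) <= dist (pi a') (pi b').
  by rewrite !pi_dist; apply: mono.
exists (@MMHom R (interp_space t01) W pi order pi_mass).
rewrite mm_cost_wnorm distortion_wnorm //.
have mm0 u : 0 <= prod_mass supp_mass supp_mass u.
  by apply: prod_mass_ge0 => z; apply/ltW/supp_mass_gt0.
have mumu u : prod_mass mu mu u =
    pushforward (fun u => (val u.1, val u.2)) (prod_mass supp_mass supp_mass) u.
  by rewrite -prod_mass_pushforward /prod_mass !pushforward_supp_mass.
rewrite (eq_wnorm _ mumu (frefl _)) wnorm_pushforward //.
rewrite -normrN -wnormZ //; apply: eq_wnorm => // u /=.
by rewrite pi_dist /interp_dist; ring.
Qed.

(** The time at which the affine function [interp_dist t] of the first pair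
    minus that of the second pair vanishes. *)
Definition crossing (u : (coupling_supp * coupling_supp) *
                           (coupling_supp * coupling_supp)) : R :=
  let P := dist (val u.1.1).1 (val u.1.2).1 - dist (val u.2.1).1 (val u.2.2).1 in
  let Q := dist (val u.1.1).2 (val u.1.2).2 - dist (val u.2.1).2 (val u.2.2).2 in
  P / (P - Q).

(** The sign at s, which is strictly inside, differs from the sign at t, which may
    be an end point; as the sign at s is weak and that at t is strict, the root
    cannot be at t. *)
Lemma affine_root_between (P Q l r s t : R) : l < s < r -> l <= t <= r ->
  (1 - s) * P + s * Q <= 0 -> 0 < (1 - t) * P + t * Q -> l < P / (P - Q) < r.
Proof.
move=> /andP[ls sr] /andP[lt tr] Ls Lt; have [PQ|PQ] := eqVneq P Q.
  by rewrite PQ in Ls Lt; lra.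
set c := P / (P - Q); have D0 : P - Q != 0 by rewrite subr_eq0.
have E x : (1 - x) * P + x * Q = (P - Q) * (c - x).
  by rewrite /c; field.
rewrite !E in Ls Lt; move: D0; rewrite neq_lt => /orP[D0|D0].
  by rewrite nmulr_rgt0 // in Lt; rewrite nmulr_rle0 // in Ls; lra.
by rewrite pmulr_rgt0 // in Lt; rewrite pmulr_rle0 // in Ls; lra.
Qed.

Lemma interp_order (l r s t : R) a b a' b' :
  (forall c, c \in codom crossing -> ~~ (l < c < r)) ->
  l < s < r -> l <= t <= r -> interp_dist s a b <= interp_dist s a' b' ->
  interp_dist t a b <= interp_dist t a' b'.
Proof.
move=> no_crit lsr ltr Ls; rewrite leNgt.
apply/negP => Lt; have /negP := no_crit _ (codom_f crossing ((a, b), (a', b'))).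
rewrite /interp_dist in Ls Lt.
by apply; apply: (affine_root_between lsr ltr); lra.
Qed.

(** Induction on the number of crossing times strictly between l and r.  Such
    a time c splits the interval into two with fewer crossings, since c is inside
    neither.  If there is none, the space at the midpoint maps to both ends. *)
Lemma interp_reach (l r : R) (Wl Wr : mmSpace R) (pil : coupling_supp -> Wl)
    (pir : coupling_supp -> Wr) : 0 <= l -> l < r -> r <= 1 ->
  realizes l pil -> realizes r pir ->
  reach (@mm_cost R p) Wl Wr ((r - l) * distortion p mu).
Proof.
have [n] := ubnP (count (fun c => l < c < r) (codom crossing)).
elim: n l r Wl Wr pil pir => // n IHn l r Wl Wr pil pir; rewrite ltnS => crit_n.
move=> l0 lr r1 l_real r_real.
have [/hasP[c c_crit /= /andP[lc cr]]|/hasPn no_crit] :=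
    boolP (has (fun c => l < c < r) (codom crossing)).
  have c01 : 0 < c < 1 by rewrite (le_lt_trans l0 lc) (lt_le_trans cr r1).
  have c_real : realizes c (id : coupling_supp -> interp_space c01).
    by split=> // z; rewrite /pushforward big_pred1_eq.
  have -> : (r - l) * distortion p mu =
      (c - l) * distortion p mu + (r - c) * distortion p mu by ring.
  have fewer l' r' : l <= l' -> r' <= r -> (l' == c) || (r' == c) ->
      (count (fun c => l' < c < r')%R (codom crossing) < n)%N.
    move=> ll' rr' cE; apply: leq_trans crit_n.
    apply: (count_ltn c_crit) => [x /andP[l'x xr']||]; last by rewrite lc.
      by rewrite (le_lt_trans ll' l'x) (lt_le_trans xr' rr').
    by case/orP: cE => /eqP ->; rewrite ltxx ?andbF.
  apply: (reach_trans (B := interp_space c01)).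
    apply: (IHn l c Wl (interp_space c01) pil id) => //; last first.
      by rewrite ltW // (lt_le_trans cr).
    by apply: fewer; rewrite ?eqxx ?orbT // ltW.
  apply: (IHn c r (interp_space c01) Wr id pir) => //; last first.
    by rewrite ltW // (le_lt_trans l0).
  by apply: fewer; rewrite ?eqxx // ltW.
pose m := (l + r) / 2.
have lm : l < m by rewrite midf_lt.
have mr : m < r by rewrite midf_lt.
have m01 : 0 < m < 1 by rewrite (le_lt_trans l0 lm) (lt_le_trans mr r1).
have lmr : l < m < r by rewrite lm mr.
have lrl : l <= l <= r by rewrite lexx ltW.
have lrr : l <= r <= r by rewrite lexx ltW.
have [f fE] := interp_hom m01 l_real
  (fun a b a' b' => @interp_order _ _ _ _ a b a' b' no_crit lmr lrl).
have [g gE] := interp_hom m01 r_real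
  (fun a b a' b' => @interp_order _ _ _ _ a b a' b' no_crit lmr lrr).
exists (ZCons (Backward f) (ZOne (Forward g))) => /=.
rewrite fE gE -mulrDl ler_wpM2r //; first by rewrite distortion_wnorm // wnorm_ge0.
by rewrite gtr0_norm ?subr_gt0 // ltr0_norm ?subr_lt0 //; lra.
Qed.

Lemma coupling_reach : reach (@mm_cost R p) X Y (distortion p mu).
Proof.
rewrite -[distortion p mu]mul1r -[1](subr0 1).
exact: (interp_reach _ _ _ realizes0 realizes1).
Qed.

End Interpolation.

Lemma catMM_dist_eq (R : realType) (p : \bar R) (X Y : mmSpace R) : (1%:E <= p)%E ->
  catMM_dist p X Y = ereal_inf (fun c : \bar R =>
     exists mu : X * Y -> R, is_coupling mu /\ c = (distortion p mu)%:E).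
Proof.
move=> p1; apply/eqP; rewrite eq_le; apply/andP; split.
  apply: le_ereal_inf_tmp => _ [mu [mu_cpl ->]].
  have [P P_cost] := coupling_reach p1 mu_cpl.
  apply: ge_ereal_inf; exists (zigzag_cost (@mm_cost R p) P)%:E; first by exists P.
  by rewrite lee_fin.
apply: le_ereal_inf_tmp => _ [P ->].
have [mu mu_cpl mu_dist] := zigzag_coupling p1 P.
apply: ge_ereal_inf; exists (distortion p mu)%:E; first by exists mu.
by rewrite lee_fin.
Qed.

(** * The morphism of diagrams induced by a morphism of spaces *)

Section OffDiagonal.
Variables (R : realType) (Q : {fset R}).

(** The sums over the intervals below J and below [lo J, lo J] differ from each
    other by the same amount for A and for B, because the correction only depends
    on lo J.  The intervals L that are below J but not below [lo J, lo J] satisfy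
    lo L <= lo J < hi L and are therefore off the diagonal, so induction applies
    to all of them but J. *)
Lemma offdiag_eq (A B : intv Q -> int) (h : Q -> int) :
  (forall J, \sum_(L | intv_le L J) A L = \sum_(L | intv_le L J) B L + h (ends J).1) ->
  forall J, ~~ in_diag J -> A J = B J.
Proof.
move=> AB J; pose down J := #|[pred L : intv Q | intv_le L J]|.
have [n] := ubnP (down J); elim: n J => // n IHn J; rewrite ltnS => Jn J_off.
pose J0 : intv Q := Intv (ends := ((ends J).1, (ends J).1)) (lexx _).
have J0J : intv_le J0 J by rewrite /intv_le lexx; apply: (ends_le J).
have sumD : \sum_(L | intv_le L J) (A L - B L) = \sum_(L | intv_le L J0) (A L - B L).
  by rewrite !sumrB !AB /= ![_ + h _]addrC !addrK.
move: sumD; rewrite (bigID (fun L => intv_le L J0)) /=.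
rewrite (eq_bigl (fun L => intv_le L J0)) => [|L]; last first.
  by apply: andb_idl => /intv_le_trans; apply.
move=> /eqP; rewrite -subr_eq0 addrC addrK (bigD1 J) /=; last first.
  rewrite intv_le_refl /intv_le lexx /= -ltNge lt_neqAle.
  by move: J_off; rewrite /in_diag => ->; apply: (ends_le J).
rewrite big1 ?addr0 ?subr_eq0 => [/eqP //|L /andP[/andP[LJ LJ0] nLJ]].
apply/eqP; rewrite subr_eq0; apply/eqP/IHn; last first.
  have /andP[loL _] := LJ; move: LJ0; rewrite /intv_le loL /= -ltNge => hiL.
  by rewrite /in_diag lt_eqF // (le_lt_trans loL).
apply: leq_trans Jn; apply/proper_card/properP; split.
  by apply/subsetP => L' /[!inE] /intv_le_trans; apply.
exists J; rewrite !inE ?intv_le_refl //; apply: contraNN nLJ => JL.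
by apply/eqP/intv_le_anti; rewrite LJ.
Qed.
End OffDiagonal.

Section InducedMorphism.
Variables (R : realType) (K : fieldType) (d : nat) (X Y : mmSpace R).
Variable f : mm_hom X Y.

(** Every point of Y has positive mass, and the mass comes from its fibre. *)
Lemma mm_fun_surj : exists s : Y -> X, cancel s f.
Proof.
have surj y : exists x, f x = y.
  have := mass_gt0 y; rewrite -(mm_fun_mass f).
  have mass0 (x : X) : 0 <= mass x by apply: ltW (mass_gt0 x).
  by move=> /(pushforward_posP _ _ mass0)[x fx _]; exists x.
have [s sK] := fin_all_exists surj; by exists s.
Qed.

Lemma dist_set_repr (q : dist_set X) : exists u, dist_to_set u == q.
Proof.
by case/imfsetP: (valP q) => u _ qu; exists u; rewrite -val_eqE /= -qu.
Qed.

Definition dist_map (q : dist_set X) : dist_set Y :=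
  let u := xchoose (dist_set_repr q) in dist_to_set (f u.1, f u.2).

(** The distance of the images of two points depends only on the distance of the
    points: this is the order condition applied in both directions. *)
Lemma dist_mapE u : dist_map (dist_to_set u) = dist_to_set (f u.1, f u.2).
Proof.
apply: val_inj => /=; set v := xchoose _.
have /eqP/(congr1 val) /= := xchooseP (dist_set_repr (dist_to_set u)).
rewrite -/v => vu.
by apply: le_anti; rewrite !(mm_fun_order f) // vu.
Qed.

Lemma dist_setW (P : dist_set X -> Prop) :
  (forall u, P (dist_to_set u)) -> forall q, P q.
Proof. by move=> Pu q; have [u /eqP <-] := dist_set_repr q. Qed.

Lemma dist_map_mono (q q' : dist_set X) :
  val q <= val q' -> val (dist_map q) <= val (dist_map q').
Proof.
move: q q'; apply: dist_setW => u; apply: dist_setW => u'.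
by rewrite !dist_mapE /=; apply: mm_fun_order.
Qed.

Lemma dist_map_bot (r : dist_set Y) :
  val (dist_map [` dist_set0 X]%fset) <= val r.
Proof.
have [u /eqP uE] := dist_set_repr [` dist_set0 X]%fset.
rewrite -uE dist_mapE; have /= /dist_eq0 -> := congr1 val uE.
rewrite (proj2 (dist_eq0 _ _) erefl); exact: dist_set_ge0 (valP r).
Qed.

Definition dist_map_upper (r : dist_set Y) : dist_set X :=
  [arg max_(q > [` dist_set0 X]%fset | val (dist_map q) <= val r) val q]%O.

Lemma dist_map_adj (q : dist_set X) (r : dist_set Y) :
  val (dist_map q) <= val r <-> val q <= val (dist_map_upper r).
Proof.
rewrite /dist_map_upper; case: arg_maxP => [|m m_r m_max]; first exact: dist_map_bot.
by split=> [/m_max //|/dist_map_mono/le_trans]; apply.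
Qed.

Lemma dist_map_upper_mono (r r' : dist_set Y) :
  val r <= val r' -> val (dist_map_upper r) <= val (dist_map_upper r').
Proof.
move=> rr'; apply/dist_map_adj; apply: le_trans rr'.
exact/dist_map_adj.
Qed.

Definition dist_galois : galois (dist_set X) (dist_set Y) :=
  Galois dist_map_mono dist_map_upper_mono dist_map_adj.

(** By adjunction, a distance in X is at most [dist_map_upper r] exactly when the
    distance of the images is at most r. *)
Lemma vr_cplx_upper (r : dist_set Y) :
  vr_cplx (dist_map_upper r) = pull_cplx f (vr_cplx r).
Proof.
have distP x x' : (dist x x' <= val (dist_map_upper r)) = (dist (f x) (f x') <= val r).
  apply/idP/idP => [le_up|le_r].
    by have := proj2 (dist_map_adj (dist_to_set (x, x')) r) le_up; rewrite dist_mapE.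
  by apply: (proj1 (dist_map_adj (dist_to_set (x, x')) r)); rewrite dist_mapE.
apply/setP => s; rewrite !inE imset_eq0; congr (_ && _).
apply/forall_inP/forall_inP => [sr _ /imsetP[x xs ->]|sr x xs].
  apply/forall_inP => _ /imsetP[x' x's ->]; rewrite -distP.
  by have /forall_inP := sr x xs; apply.
apply/forall_inP => x' x's; rewrite distP.
by have /forall_inP := sr _ (imset_f f xs); apply; apply: imset_f.
Qed.

(** The intervals of X whose image is below J are those below the image of J under
    the upper adjoint.  So the sum of the pushed-forward diagram below J is ZB at
    a pair of scales where the complexes of X are the preimages of those of Y, and
    it differs from ZB of Y at J by a function of the left end point of J. *)
Lemma induced_mult J : ~~ in_diag J ->
  pd K d (vr_filtration Y) J =
  (\sum_(I | gal_bar dist_galois I == J) pd K d (vr_filtration X) I)%N.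
Proof.
move=> J_off; apply/eqP; rewrite -eqz_nat; apply/eqP.
pose dimZ (V : finType) (S : {set {set V}}) := \dim (cycles K d S).
apply: (@offdiag_eq _ _ (fun J => (pd K d (vr_filtration Y) J)%:Z)
  (fun J => (\sum_(I | gal_bar dist_galois I == J)
     pd K d (vr_filtration X) I)%N%:Z)
  (fun a => (dimZ _ (vr_cplx a))%:Z -
     (dimZ _ (vr_cplx (dist_map_upper a)))%:Z)) => // {}J {J_off}.
rewrite -!(big_morph Posz PoszD (erefl 0%:Z)) -pdP.
pose I : intv (dist_set X) :=
  Intv (ends := (dist_map_upper (ends J).1, dist_map_upper (ends J).2))
    (dist_map_upper_mono (ends_le J)).
have -> : (\sum_(L | intv_le L J) \sum_(I | gal_bar dist_galois I == L)
      pd K d (vr_filtration X) I = zb K d (vr_filtration X) I)%N.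
  rewrite pdP (partition_big (gal_bar dist_galois) (fun L => intv_le L J)) /= => [|L].
    apply: eq_bigr => L LJ; apply: eq_bigl => L'; rewrite andbC.
    apply/esym/andb_idr => /eqP LE; rewrite -LE in LJ; move/andP: LJ => [lo_le hi_le].
    by apply/andP; split; apply/dist_map_adj.
  by move=> /andP[lo_le hi_le]; apply/andP; split; apply/dist_map_adj.
have [s sK] := mm_fun_surj.
have := pull_cplx_dim K d sK (vr_mono (ends_le J)).
rewrite -!vr_cplx_upper /zb /dimZ /=; lia.
Qed.

Lemma gal_bar_flip u :
  gal_bar dist_galois (flip u) = flip (dist_map u.1, dist_map u.2).
Proof.
case: u => q q' /=; rewrite /flip /gal_bar; apply: val_inj => /=.
case: (leP (val q) (val q')) => [qq'|/ltW q'q] /=; first by rewrite dist_map_mono.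
case: (leP (val (dist_map q)) (val (dist_map q'))) => //= le1.
have E : dist_map q = dist_map q'.
  by apply: val_inj; apply: le_anti; rewrite le1 dist_map_mono.
by rewrite E.
Qed.

Lemma pushforward_gdd : pushforward dist_map (@gdd R X) =1 @gdd R Y.
Proof.
move=> r; rewrite pushforward_comp /gdd.
have prod_mm : pushforward (fun u => (f u.1, f u.2))
    (prod_mass (@mass R X) (@mass R X)) =1 prod_mass (@mass R Y) (@mass R Y).
  by move=> u; rewrite -prod_mass_pushforward /prod_mass !(mm_fun_mass f).
rewrite -(eq_pushforward (frefl _) prod_mm) pushforward_comp.
by apply: eq_pushforward => // u; apply: dist_mapE.
Qed.

Lemma induced_wt :
  pushforward (gal_bar dist_galois) (@flip_wt R X (weighted_vr X)) =1
  @flip_wt R Y (weighted_vr Y).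
Proof.
move=> J; rewrite pushforward_comp /flip_wt /=.
rewrite (@eq_pushforward _ _ _ _ _ _ _ (gal_bar_flip) (frefl _)).
have prod_gdd : pushforward (fun u => (dist_map u.1, dist_map u.2))
    (prod_mass (@gdd R X) (@gdd R X)) =1 prod_mass (@gdd R Y) (@gdd R Y).
  by move=> u; rewrite -prod_mass_pushforward /prod_mass !pushforward_gdd.
by rewrite -(eq_pushforward (frefl _) prod_gdd) pushforward_comp.
Qed.

Definition induced_hom : wdgm_hom (wpd_vr K d X) (wpd_vr K d Y) :=
  @WDgmHom R (wpd_vr K d X) (wpd_vr K d Y) dist_galois induced_mult induced_wt.

Variable p : \bar R.
Hypothesis p1 : (1%:E <= p)%E.

Notation delta q := (val q - val (dist_map q)).

(** Each entry of the displacement is a difference of the changes of two end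
    points, hence at most twice the largest change. *)
Lemma displacement_flip (u v : dist_set X * dist_set X) :
  exists q, q \in [:: u.1; u.2; v.1; v.2] /\
  displacement (flip u) (flip v) (gal_bar dist_galois (flip u))
    (gal_bar dist_galois (flip v)) <= 2 * `|delta q|.
Proof.
have [q q_in q_max] : exists2 q, q \in [:: u.1; u.2; v.1; v.2] &
    forall q', q' \in [:: u.1; u.2; v.1; v.2] -> `|delta q'| <= `|delta q|.
  have u1_in : u.1 \in [:: u.1; u.2; v.1; v.2] by rewrite mem_head.
  case: (@arg_maxP _ _ _ u.1 [in [:: u.1; u.2; v.1; v.2]] (fun q => `|delta q|) u1_in).
  by move=> q q_in q_max; exists q.
exists q; split=> //.
have ends_in (w : dist_set X * dist_set X) :
    {subset [:: w.1; w.2] <= [:: u.1; u.2; v.1; v.2]} ->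
    (ends (flip w)).1 \in [:: u.1; u.2; v.1; v.2] /\
    (ends (flip w)).2 \in [:: u.1; u.2; v.1; v.2].
  move=> sub; rewrite /flip /=; case: ifP => _ /=.
    by split; apply: sub; rewrite !inE eqxx ?orbT.
  by split; apply: sub; rewrite !inE eqxx ?orbT.
have [|u1 u2] := ends_in u; first by move=> x; rewrite !inE => /orP[]->; rewrite ?orbT.
have [|v1 v2] := ends_in v; first by move=> x; rewrite !inE => /orP[]->; rewrite ?orbT.
have bound x y : `|delta x| <= `|delta q| -> `|delta y| <= `|delta q| ->
    `|(val x - val y) - (val (dist_map x) - val (dist_map y))| <= 2 * `|delta q|.
  move=> xq yq; have -> : val x - val y - (val (dist_map x) - val (dist_map y)) =
    delta x - delta y by ring.
  by apply: le_trans (ler_normB _ _) _; rewrite mulr2n mulrDl mul1r lerD.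
by rewrite /displacement !ge_max !bound //; apply: q_max.
Qed.

(** A pair of random intervals is given by four distances, each distributed as the
    distance of two random points, and the change of a distance under f is the
    integrand of the cost of f. *)
Lemma wdgm_cost_induced :
  wdgm_cost p induced_hom <= 2 * 4 `^ exponent_inv p * mm_cost p f.
Proof.
pose g := prod_mass (@gdd R X) (@gdd R X).
have gdd0 q : 0 <= gdd (X := X) q by rewrite ltW ?gdd_gt0.
have g0 u : 0 <= g u by apply: prod_mass_ge0.
have wt0 I : 0 < @flip_wt R X (weighted_vr X) I by apply: flip_wt_gt0.
have -> : wdgm_cost p induced_hom = wnorm p (prod_mass g g)
    (fun u => displacement (flip u.1) (flip u.2) (gal_bar dist_galois (flip u.1))
       (gal_bar dist_galois (flip u.2))).
  transitivity (wnorm p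
    (prod_mass (@flip_wt R X (weighted_vr X)) (@flip_wt R X (weighted_vr X)))
    (fun u => displacement u.1 u.2 (gal_bar dist_galois u.1)
       (gal_bar dist_galois u.2))).
    by apply: pnorm_wnorm => u; rewrite /prod_mass mulr_gt0 ?wt0.
  rewrite (eq_wnorm _ (prod_mass_pushforward _ _ _ _) (frefl _)).
  by rewrite wnorm_pushforward // => u; apply: prod_mass_ge0.
have -> : mm_cost p f = wnorm p (@gdd R X) (fun q => delta q).
  rewrite mm_cost_wnorm wnorm_pushforward => [|u]; last first.
    by apply: prod_mass_ge0 => x; apply/ltW/mass_gt0.
  by apply: eq_wnorm => // u; rewrite -[RHS]/(delta (dist_to_set u)) dist_mapE.
rewrite [2 * _]mulrC -mulrA -[X in X * wnorm _ _ _]ger0_norm // -wnormZ //.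
(* The four scales from which the two intervals are formed. *)
pose pi (k : 'I_4) (u : (dist_set X * dist_set X) * (dist_set X * dist_set X)) :=
  tnth [tuple u.1.1; u.1.2; u.2.1; u.2.2] k.
apply: (@ler_wnorm_family _ _ p1 _ _ 4 pi) => // [u|k|u].
- exact: prod_mass_ge0.
- have g1 : \sum_u g u = 1 by rewrite prod_mass_sum gdd_sum mulr1.
  have proj pik h1 h2 : pushforward h1 (prod_mass g g) =1 g ->
      pushforward h2 g =1 @gdd R X -> pik =1 h2 \o h1 ->
      pushforward pik (prod_mass g g) =1 @gdd R X.
    move=> h1g h2g pikE q; rewrite -h2g -(eq_pushforward (frefl h2) h1g).
    by rewrite pushforward_comp; apply: eq_pushforward.
  case: k => -[|[|[|[|//]]]] k4.
  + apply: (proj _ _ _ (pushforward_fst _ g1) (pushforward_fst _ (gdd_sum X))) => u.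
    by rewrite /pi (tnth_nth u.1.1).
  + apply: (proj _ _ _ (pushforward_fst _ g1) (pushforward_snd _ (gdd_sum X))) => u.
    by rewrite /pi (tnth_nth u.1.1).
  + apply: (proj _ _ _ (pushforward_snd _ g1) (pushforward_fst _ (gdd_sum X))) => u.
    by rewrite /pi (tnth_nth u.1.1).
  + apply: (proj _ _ _ (pushforward_snd _ g1) (pushforward_snd _ (gdd_sum X))) => u.
    by rewrite /pi (tnth_nth u.1.1).
have [q [q_in q_le]] := displacement_flip u.1 u.2.
have /(nthP q)[k k4 kE] := q_in; exists (Ordinal k4); rewrite /pi (tnth_nth q) kE.
rewrite normrM (ger0_norm (ler0n R 2)).
suff disp0 : 0 <= displacement (flip u.1) (flip u.2) (gal_bar dist_galois (flip u.1))
    (gal_bar dist_galois (flip u.2)) by rewrite (ger0_norm disp0).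
by rewrite /displacement !le_max normr_ge0.
Qed.

End InducedMorphism.

Lemma wdgm_dist_le (R : realType) (K : fieldType) d (X Y : mmSpace R) (p : \bar R) :
  (1%:E <= p)%E ->
  (wdgm_dist p (wpd_vr K d X) (wpd_vr K d Y) <=
   (2 * 4 `^ exponent_inv p)%:E * catMM_dist p X Y)%E.
Proof.
move=> p1; have c0 : 0 < 2 * 4 `^ exponent_inv p :> R by rewrite mulr_gt0 ?powR_gt0.
rewrite -lee_pdivrMl //; apply: le_ereal_inf_tmp => _ [P ->]; rewrite lee_pdivrMl //.
suff [Q Q_cost] : reach (@wdgm_cost R p) (wpd_vr K d X) (wpd_vr K d Y)
    (2 * 4 `^ exponent_inv p * zigzag_cost (@mm_cost R p) P).
  apply: ge_ereal_inf; exists (zigzag_cost (@wdgm_cost R p) Q)%:E.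
    by exists Q.
  by rewrite lee_fin.
have step_reach A B (s : step (@mm_hom R) A B) :
    reach (@wdgm_cost R p) (wpd_vr K d A) (wpd_vr K d B)
      (2 * 4 `^ exponent_inv p * step_cost (@mm_cost R p) s).
  case: s => f.
    by exists (ZOne (Forward (induced_hom K d f))); apply: wdgm_cost_induced.
  by exists (ZOne (Backward (induced_hom K d f))); apply: wdgm_cost_induced.
elim: P => [A B s|A B C s P IHP] /=; first exact: step_reach.
by rewrite mulrDr; apply: reach_trans IHP; apply: step_reach.
Qed.

Theorem theorem1p2p2 (R : realType) (K : fieldType) (X Y : mmSpace R)
    (p : \bar R) (hp : (1%:E <= p)%E) (d : nat) :
  (wdgm_dist p (wpd_vr K d X) (wpd_vr K d Y)
     <= (2 * 4 `^ exponent_inv p)%:E * catMM_dist p X Y)%E /\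
  ((2 * 4 `^ exponent_inv p)%:E * catMM_dist p X Y
     = (4 `^ exponent_succ_div p)%:E * gw_dist p X Y)%E.
Proof.
split; first exact: wdgm_dist_le.
rewrite catMM_dist_eq // /gw_dist muleA; congr (_ * _)%E.
rewrite -EFinM; congr (_%:E).
case: p hp => [r|_|//]; rewrite /exponent_inv /exponent_succ_div.
  rewrite lee_fin => r1; have r0 : r != 0 by rewrite gt_eqF // (lt_le_trans _ r1).
  have -> : (r + 1) / r = 1 + r^-1 by field.
  rewrite powRD ?pnatr_eq0 ?implybT // powRr1 //.
  by rewrite mulrAC; congr (_ * _); lra.
by rewrite powRr0 powRr1 //; lra.
Qed.
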